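(* Let $1<q<\infty$ and let $\bm{f}=\{f_j\}_{j=1}^\infty$ be a sequence of functions on $\mathbb{R}^n$ such that for each $\varepsilon>0$ $$\left|\left\{x\in[-R,R]^n : |\overline{M}_q\bm{f}(x)|>\varepsilon\right\}\right|=o(R^n)\quad\text{as } R\to\infty .$$ Then there exist $3^n$ dyadic lattices $\mathcal{D}_k$ and $3^n$ $\frac16$-sparse families $\mathcal{S}_k\subseteq\mathcal{D}_k$ ($k=1,\dots,3^n$), depending on $\bm{f}$, such that for almost every $x\in\mathbb{R}^n$ $$|\overline{M}_q\bm{f}(x)|\le c_{n,q}\sum_{k=1}^{3^n}\mathcal{A}^q_{\mathcal{S}_k}|\bm{f}|_q(x),\qquad \mathcal{A}^q_{\mathcal{S}_k}|\bm{f}|_q(x)=\left(\sum_{Q\in\mathcal{S}_k}\langle|\bm{f}|_q\rangle_Q^q\,\chi_Q(x)\right)^{1/q},$$ where $c_{n,q}$ is a constant depending only on $n$ and $q$.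
   Context: Cubes in $\mathbb{R}^n$ have sides parallel to the axes. $M$ is the Hardy–Littlewood maximal operator, $Mf(x)=\sup_{Q\ni x}\frac1{|Q|}\int_Q|f|$. $|\bm{f}|_q(x)=\left(\sum_{j=1}^\infty|f_j(x)|^q\right)^{1/q}$, $\overline{M}_q\bm{f}(x)=\left(\sum_{j=1}^\infty Mf_j(x)^q\right)^{1/q}$, and $\langle h\rangle_Q=\frac1{|Q|}\int_Q h$. For a cube $Q$, $\mathcal{D}(Q)$ denotes the dyadic grid obtained by repeatedly subdividing $Q$ and its descendants into $2^n$ cubes of equal side length. A dyadic lattice $\mathcal{D}$ is a family of cubes such that: (1) if $Q\in\mathcal{D}$ then every descendant of $Q$ (element of $\mathcal{D}(Q)$) is in $\mathcal{D}$; (2) for any $Q_1,Q_2\in\mathcal{D}$ there is $Q\in\mathcal{D}$ with $Q_1,Q_2\in\mathcal{D}(Q)$; (3) for every compact set $K$ there is $Q\in\mathcal{D}$ with $K\subseteq Q$. A family $\mathcal{S}\subseteq\mathcal{D}$ is $\eta$-sparse, $\eta\in(0,1)$, if for each $Q\in\mathcal{S}$ there is a measurable $E_Q\subseteq Q$ with $\eta|Q|\le|E_Q|$ and the sets $E_Q$ are pairwise disjoint. *)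

(* Defs.v *)
From HB Require Import structures.
From mathcomp Require Import all_boot all_order all_algebra.
From mathcomp Require Import all_classical all_reals all_analysis.

Set Implicit Arguments.
Unset Strict Implicit.
Unset Printing Implicit Defensive.

Import Order.TTheory GRing.Theory Num.Def Num.Theory.
Import numFieldNormedType.Exports.

Local Open Scope classical_set_scope.
Local Open Scope ring_scope.

Definition rV_display : measure_display.
Proof. exact. Qed.

Definition coors (R : realType) (n : nat) (i : 'I_n) (x : 'rV[R]_n) :
  measurableTypeR R := x 0 i.

(* Borel sigma-algebra of R^n, presented as the product sigma-algebra. *)
HB.instance Definition _ (R : realType) (n : nat) :=
  @isMeasurable.Build rV_display 'rV[R]_n (g_sigma_preimage (@coors R n))
    (@sigma_algebra0 _ _ _) (@sigma_algebraC _ _) (@sigma_algebra_bigcup _ _ _).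

Section borel_lebesgue.
Variable R : realType.

Lemma measurable_coors n (i : 'I_n) : measurable_fun [set: 'rV[R]_n] (coors i).
Proof.
move=> _ Y mY; rewrite setTI; apply: sub_sigma_algebra => /=.
rewrite -bigcup_seq/=; exists i => /=; first by rewrite mem_index_enum.
by exists Y => //; rewrite setTI.
Qed.

Lemma measurable_fun_coorsP d (T : measurableType d) n (f : T -> 'rV[R]_n) :
  (forall i, measurable_fun [set: T] (coors i \o f)) -> measurable_fun [set: T] f.
Proof.
move=> mf _ A mA; rewrite setTI.
suff : @measurable _ 'rV[R]_n `<=` [set B | measurable (f @^-1` B)] by apply.
apply: smallest_sub => [|B].
  split => [|B mB|F mF] /=.
  - by rewrite preimage_set0.
  - by rewrite setTD preimage_setC; exact: measurableC.
  - by rewrite preimage_bigcup; apply: bigcup_measurable => k _; exact: mF.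
rewrite -bigcup_seq/= => -[i _ [C mC <-]].
by rewrite setTI -[X in measurable X]setTI; exact: mf.
Qed.

Definition rV_cons n (p : measurableTypeR R * 'rV[R]_n) : 'rV[R]_n.+1 :=
  row_mx (const_mx p.1 : 'rV_1) p.2.

Definition rV_uncons n (x : 'rV[R]_n.+1) : measurableTypeR R * 'rV[R]_n :=
  (x 0 0, @rsubmx R 1 1 n x).

Lemma measurable_rV_cons n : measurable_fun setT (@rV_cons n).
Proof.
apply: measurable_fun_coorsP => i.
have [j ij|j ij] := @splitP 1 n i.
  rewrite (_ : _ \o _ = fst)//.
  apply/funext => p /=; rewrite /coors /rV_cons.
  have -> : i = lshift n j by exact/val_inj.
  by rewrite [LHS](@row_mxEl _ 1 1 n) mxE.
rewrite (_ : _ \o _ = coors j \o snd); last first.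
  apply/funext => p /=; rewrite /coors /rV_cons.
  have -> : i = rshift 1 j by exact/val_inj.
  by rewrite [LHS](@row_mxEr _ 1 1 n).
by apply: measurableT_comp => //; exact: measurable_coors.
Qed.

Lemma measurable_rV_uncons n : measurable_fun setT (@rV_uncons n).
Proof.
apply: measurable_fun_pair => /=; first exact: (@measurable_coors _ ord0).
apply: measurable_fun_coorsP => i.
rewrite (_ : _ \o _ = coors (rshift 1 i)); first exact: measurable_coors.
by apply/funext => x /=; rewrite /coors mxE.
Qed.

Section step.
Variables (n : nat) (m : {sigma_finite_measure set 'rV[R]_n -> \bar R}).

Definition lebesgue_rV_step : set 'rV[R]_n.+1 -> \bar R :=
  pushforward (lebesgue_measure \x m)%E (@rV_cons n).

Let step0 : lebesgue_rV_step set0 = 0%E.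
Proof. by rewrite /lebesgue_rV_step /pushforward preimage_set0 measure0. Qed.

Let step_ge0 A : (0 <= lebesgue_rV_step A)%E.
Proof. exact: (measure_ge0 (lebesgue_measure \x m)%E). Qed.

Let step_sigma_additive : semi_sigma_additive lebesgue_rV_step.
Proof.
move=> F mF tF mUF; rewrite /lebesgue_rV_step /pushforward preimage_bigcup.
apply: measure_semi_sigma_additive.
- by move=> k; rewrite -[X in measurable X]setTI; exact: measurable_rV_cons.
- apply/trivIsetP => /= i j _ _ ij; rewrite -preimage_setI.
  by move/trivIsetP : tF => /(_ _ _ _ _ ij) ->//; rewrite preimage_set0.
- rewrite -preimage_bigcup -[X in measurable X]setTI.
  exact: measurable_rV_cons.
Qed.

HB.instance Definition _ := isMeasure.Build _ _ _ lebesgue_rV_step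
  step0 step_ge0 step_sigma_additive.

Let step_sigma_finite : sigma_finite setT lebesgue_rV_step.
Proof.
have [F TF Foo] : sigma_finite setT (lebesgue_measure \x m)%E.
  have /sigma_finiteP[F [TF ndF Foo]] :=
    sigma_finiteT (@lebesgue_measure R : {sigma_finite_measure set _ -> \bar R}).
  have /sigma_finiteP[G [TG ndG Goo]] := sigma_finiteT m.
  exists (fun k => F k `*` G k).
    rewrite -setXTT TF TG predeqE => -[x y]; split.
      move=> [/= [i _ Fix] [k _ Gky]]; exists (maxn i k) => //; split.
      - by move: x Fix; exact/subsetPset/ndF/leq_maxl.
      - by move: y Gky; exact/subsetPset/ndG/leq_maxr.
    by move=> [i _ []/= ? ?]; split; exists i.
  move=> k; have [? ?] := Foo k; have [? ?] := Goo k.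
  split; first exact: measurableX.
  by rewrite product_measure1E// lte_mul_pinfty// ge0_fin_numE.
exists (fun k => @rV_uncons n @^-1` F k).
  by rewrite -preimage_bigcup -TF preimage_setT.
move=> k; have [mF Fk] := Foo k; split.
  by rewrite -[X in measurable X]setTI; exact: measurable_rV_uncons.
rewrite /lebesgue_rV_step /pushforward -comp_preimage.
rewrite (_ : _ \o _ = id)//; apply/funext => -[x v] /=.
rewrite /rV_uncons /rV_cons row_mxKr; congr pair.
have -> : 0 = lshift n 0 :> 'I_(1 + n) by exact/val_inj.
by rewrite [LHS](@row_mxEl _ 1 1 n) mxE.
Qed.

HB.instance Definition _ := Measure_isSigmaFinite.Build _ _ _ lebesgue_rV_step
  step_sigma_finite.

End step.

(* Lebesgue measure on Borel sets, as the n-fold product of lebesgue_measure. *)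
Fixpoint lebesgue_rV (n : nat) : {sigma_finite_measure set 'rV[R]_n -> \bar R} :=
  match n with
  | 0 => \d_(0 : 'rV[R]_0)
  | k.+1 => lebesgue_rV_step (lebesgue_rV k)
  end.

End borel_lebesgue.

(* R^n with the Lebesgue measurable sets, and Lebesgue measure on them: the
   (complete) Caratheodory extension of Lebesgue measure on Borel sets. *)
Notation Rn R n := (caratheodory_type (mu_ext (@lebesgue_rV R n))).

Section lebesgue.
Variables (R : realType) (n : nat).

Definition leb : set (Rn R n) -> \bar R :=
  @completed_measure_extension _ 'rV[R]_n R (lebesgue_rV R n).

HB.instance Definition _ := Measure.on leb.

Let leb_sigma_finite : sigma_finite setT leb.
Proof. exact/completed_measure_extension_sigma_finite/sigma_finiteT. Qed.

HB.instance Definition _ := Measure_isSigmaFinite.Build _ _ _ leb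
  leb_sigma_finite.

End lebesgue.
Arguments leb {R n}.

(* Half-open cubes, so that the 2^n children of a cube partition it; averages
   and maximal functions are insensitive to the choice of boundary. *)
Record cube (R : realType) (n : nat) :=
  Cube { corner : 'rV[R]_n ; side : {posnum R} }.

HB.instance Definition _ (R : realType) (n : nat) := gen_eqMixin (cube R n).
HB.instance Definition _ (R : realType) (n : nat) := gen_choiceMixin (cube R n).

Section cubes.
Context {R : realType} {n : nat}.
Implicit Types (Q P : cube R n) (D S : set (cube R n)).

Definition cube_set Q : set (Rn R n) :=
  [set x : 'rV[R]_n |
    forall i, corner Q 0 i <= x 0 i < corner Q 0 i + (side Q)%:num].

Definition child Q (e : {ffun 'I_n -> bool}) : cube R n :=
  Cube (\row_i (corner Q 0 i + (e i)%:R * ((side Q)%:num / 2)))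
       ((side Q)%:num / 2)%:pos.

Inductive dyadic_grid Q : set (cube R n) :=
  | dyadic_grid_refl : dyadic_grid Q Q
  | dyadic_grid_child P e : dyadic_grid Q P -> dyadic_grid Q (child P e).

Definition dyadic_lattice D : Prop :=
  [/\ forall Q, D Q -> dyadic_grid Q `<=` D,
      forall Q1 Q2, D Q1 -> D Q2 ->
        exists Q, [/\ D Q, dyadic_grid Q Q1 & dyadic_grid Q Q2]
    & forall K : set 'rV[R]_n, compact K -> exists2 Q, D Q & K `<=` cube_set Q].

Definition sparse (eta : R) S : Prop :=
  exists E : cube R n -> set (Rn R n),
    (forall Q, S Q -> [/\ measurable (E Q), E Q `<=` cube_set Q
       & (eta%:E * leb (cube_set Q) <= leb (E Q))%E])
    /\ trivIset S E.

End cubes.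

Section volume.
Context {R : realType}.

Definition box n (a : 'rV[R]_n) (l : R) : set 'rV[R]_n :=
  [set x | forall i, a 0 i <= x 0 i < a 0 i + l].

Lemma measurable_box n (a : 'rV[R]_n) l : measurable (box a l).
Proof.
rewrite (_ : box a l =
  \bigcap_(i in [set: 'I_n]) (coors i @^-1` `[a 0 i, a 0 i + l[)).
  apply: fin_bigcap_measurable => // i _.
  rewrite -[X in measurable X]setTI; apply: measurable_coors => //.
apply/seteqP; split => x /= h i; first by move=> _ /=; rewrite in_itv/=; exact: h.
by have := h i Logic.I; rewrite /= in_itv.
Qed.

Lemma lebesgue_box n (a : 'rV[R]_n) l :
  0 < l -> lebesgue_rV R n (box a l) = (l ^+ n)%:E.
Proof.
move=> l0; elim: n a => [|n IH] a.
  by rewrite /= diracE mem_set//; case.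
rewrite /= /lebesgue_rV_step /pushforward.
have -> : rV_cons (n:=n) @^-1` box a l =
  `[a 0 0, a 0 0 + l[ `*` box (@rsubmx R 1 1 n a) l.
  apply/seteqP; split => -[x v] /=.
    move=> h; split; last first.
      move=> i; have := h (rshift 1 i).
      by rewrite [rV_cons _ _ _](@row_mxEr _ 1 1 n) mxE.
    have := h (@lshift 1 n 0).
    rewrite [rV_cons _ _ _](@row_mxEl _ 1 1 n) mxE /= in_itv /=.
    by have -> : @lshift 1 n 0 = 0 :> 'I_(1+n) by exact/val_inj.
  move=> [h1 h2] i.
  have [j ij|j ij] := @splitP 1 n i.
    have -> : i = lshift n j by exact/val_inj.
    rewrite [rV_cons _ _ _](@row_mxEl _ 1 1 n) mxE /=.
    rewrite ord1; have -> : @lshift 1 n 0 = 0 :> 'I_(1+n) by exact/val_inj.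
    by move: h1; rewrite in_itv.
  have -> : i = rshift 1 j by exact/val_inj.
  rewrite [rV_cons _ _ _](@row_mxEr _ 1 1 n).
  by have := h2 j; rewrite mxE.
rewrite product_measure1E; [|exact: measurable_itv|exact: measurable_box].
rewrite [X in (_ * X)%E](IH (@rsubmx R 1 1 n a)).
rewrite [X in (X * _)%E](@lebesgue_measure_itv R `[a 0 0, a 0 0 + l[)/=
  lte_fin ltrDl l0 -EFinD addrAC subrr add0r.
by rewrite -EFinM -exprS.
Qed.

Lemma leb_cube n (Q : cube R n) : leb (cube_set Q) = ((side Q)%:num ^+ n)%:E.
Proof.
have E := measurable_mu_extE (lebesgue_rV R n)
  (measurable_box (corner Q) (side Q)%:num).
rewrite /leb /completed_measure_extension; refine (etrans E _).
exact: lebesgue_box.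
Qed.
End volume.

Section operators.
Context {R : realType} {n : nat}.
Local Open Scope ereal_scope.

Definition avg (h : Rn R n -> \bar R) (Q : cube R n) : \bar R :=
  (leb (cube_set Q))^-1 * \int[@leb R n]_(y in cube_set Q) h y.

Definition maximal (g : Rn R n -> R) (x : Rn R n) : \bar R :=
  ereal_sup [set avg (fun y => `|g y|%:E) Q | Q in [set Q | cube_set Q x]].

(* Sequences are indexed from 0; the l^q norms take values in [0, +oo]. *)
Definition lq_norm (q : R) (f : nat -> Rn R n -> R) (x : Rn R n) : \bar R :=
  (\sum_(j <oo) `|f j x|%:E `^ q) `^ q^-1.

Definition vmaximal (q : R) (f : nat -> Rn R n -> R) (x : Rn R n) : \bar R :=
  (\sum_(j <oo) maximal (f j) x `^ q) `^ q^-1.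

Definition sparse_op (q : R) (S : set (cube R n)) (h : Rn R n -> \bar R)
    (x : Rn R n) : \bar R :=
  (\esum_(Q in S) (avg h Q `^ q * (\1_(cube_set Q) x)%:E)) `^ q^-1.

Definition centered_box (r : R) : set (Rn R n) :=
  [set x : 'rV[R]_n | forall i, (- r <= x 0 i <= r)%R].

End operators.

(* Main.v *)
Require Import Defs.
From mathcomp Require Import all_boot all_order all_algebra.
From mathcomp Require Import all_classical all_reals all_analysis.
From mathcomp Require Import measurable_realfun ring lra.

Import Order.TTheory GRing.Theory Num.Def Num.Theory.
Import numFieldNormedType.Exports.

Local Open Scope classical_set_scope.
Local Open Scope ring_scope.

(** Fix a dyadic lattice and let F be the pointwise l^q norm of the f_j.
    Write F_Q for the average of F over Q.  For a cube A and a point x of A,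
    follow the dyadic cubes shrinking from A to x, and let m_j be the running
    maximum of the averages of |f_j| along the way.  The vector-valued weak
    type inequality, in the local form of [vector_weak_type], says that the
    sum of the m_j^q is at most a constant times F_A^q except on a set of
    measure at most |A|/3.

    Stop as soon as this bound fails, and restart from the cube reached.  As
    the q-th power of the maximum of two numbers is at most the sum of their
    q-th powers, the whole history costs at most the sum of F_A^q over the
    stopping cubes A met on the way ([stopped_sum_dominates]).  This holds at
    every point and at every depth, so no differentiation theorem intervenes.

    The process starts at arbitrarily large cubes.  Each lattice is built from
    a chain of cubes growing to the whole space, and every cube of the chain is
    declared to be a stopping cube; the stopping process below a chain cube
    thus forgets where it was started from, and the starting cube can be sent
    to infinity.  Sparsity survives: in a cube A one discards the next smaller
    chain cube, at most half of A, and the exceptional set of the weak type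
    inequality, at most a third of A; what remains has measure at least |A|/6
    and is met by no later stopping cube ([stopping_sparse]).

    Two shifted chains per coordinate suffice for every cube to lie in a
    lattice cube at most six times larger ([cube_cover]): at each scale the two
    grids of endpoints are a third of a step apart.  Hence the maximal function
    is bounded by the supremum of the dyadic ones ([maximal_sum_le]).

    The weak type inequality itself is a single induction on the number of
    generations, with a Bellman function: up to a multiple of m^q, the power M^q
    is at most a function [doob_fun] of M and of the current average m, which is
    affine in m and does not increase when M is replaced by max(M, m).  This is
    Doob's L^q inequality; it is applied while F_P stays below a level, which
    turns q-th powers of F_P into multiples of F_P. *)

(** * Powers and a Bellman function for Doob's inequality *)
Section powers.
Context {R : realType} (q : R).
Hypothesis q_gt1 : 1 < q.
Implicit Types a b m M : R.

Let q_gt0 : 0 < q. Proof. exact: lt_trans q_gt1. Qed.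
Let q1_gt0 : 0 < q - 1. Proof. by rewrite subr_gt0. Qed.

Lemma young_powR {a b} : 0 <= a -> 0 <= b ->
  q * (a `^ (q - 1) * b) <= (q - 1) * a `^ q + b `^ q.
Proof.
move=> a0 b0.
have q0 : q != 0 by rewrite gt_eqF.
have q10 : q - 1 != 0 by rewrite gt_eqF.
have := @conjugate_powR R _ _ (q / (q - 1)) q (powR_ge0 a (q - 1)) b0.
rewrite divr_gt0// q_gt0 => /(_ isT isT).
rewrite -powRrM.
have -> : (q - 1) * (q / (q - 1)) = q by field.
have -> : (q / (q - 1))^-1 + q^-1 = 1 by field; rewrite q0 q10.
move=> /(_ erefl); rewrite -(ler_pM2l q_gt0) => /le_trans; apply.
by rewrite le_eqVlt; apply/orP; left; apply/eqP; field; rewrite q0 q10.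
Qed.

Lemma powRB1_mull {a} : 0 <= a -> a `^ (q - 1) * a = a `^ q.
Proof. by move=> a0; rewrite mulrC mulr_powRB1. Qed.

(** A form of Young's inequality with constant 1: compare with the larger of
    the two numbers. *)
Lemma powRB1_mul_le {a b} : 0 <= a -> 0 <= b ->
  a `^ (q - 1) * b <= a `^ q + b `^ q.
Proof.
move=> a0 b0; have [ba|ab] := leP b a.
  rewrite -[leLHS]addr0 lerD ?powR_ge0//.
  by rewrite -(powRB1_mull a0) ler_wpM2l ?powR_ge0.
rewrite -[leLHS]add0r lerD ?powR_ge0// -(powRB1_mull b0) ler_wpM2r//.
by rewrite ge0_ler_powR ?nnegrE ?(ltW q1_gt0) ?(ltW ab).
Qed.

Definition doob_cst : R := 2 * q / (q - 1).

Lemma doob_cst_ge1 : 1 <= doob_cst.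
Proof.
by move: q_gt1 => q1; rewrite /doob_cst ler_pdivlMr// mul1r; lra.
Qed.

(** Bellman function of Doob's L^q maximal inequality: M stands for the current
    value of the maximum and m for the current average. *)
Definition doob_fun M m : R := 2 * M `^ q - doob_cst * (M `^ (q - 1) * m).

Lemma doob_fun_leaf {M m} : 0 <= M -> 0 <= m ->
  M `^ q <= doob_cst `^ q * m `^ q + doob_fun M m.
Proof.
move=> M0 m0; have c0 := le_trans ler01 doob_cst_ge1.
have := powRB1_mul_le M0 (mulr_ge0 c0 m0).
by rewrite powRM// /doob_fun [in X in X -> _]mulrCA; lra.
Qed.

(** When m exceeds M, both sides agree at m = M, and the inequality to prove is
    the tangent-line form of Young's inequality.  The constant [doob_cst] is
    the one making these tangents match. *)
Lemma doob_fun_max {M m} : 0 <= M -> 0 <= m ->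
  doob_fun (Num.max M m) m <= doob_fun M m.
Proof.
move=> M0 m0; rewrite /doob_fun; case: (leP m M) => // Mm.
rewrite powRB1_mull//.
have -> : doob_cst = 2 + 2 / (q - 1) by rewrite /doob_cst; field; rewrite gt_eqF.
have : (2 / (q - 1)) * (q * (M `^ (q - 1) * m)) <=
       (2 / (q - 1)) * ((q - 1) * M `^ q + m `^ q).
  by rewrite ler_pM2l ?divr_gt0//; exact: young_powR.
have q10 : q - 1 != 0 by rewrite gt_eqF.
set X := M `^ _ * m.
have -> : 2 / (q - 1) * (q * X) = (2 + 2 / (q - 1)) * X by field.
have -> : 2 / (q - 1) * ((q - 1) * M `^ q + m `^ q) =
  2 * M `^ q + 2 / (q - 1) * m `^ q by field.
by lra.
Qed.

Lemma doob_fun_diag {m} : 0 <= m -> doob_fun m m <= 0.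
Proof.
move=> m0; rewrite /doob_fun powRB1_mull// subr_le0 ler_wpM2r ?powR_ge0//.
by rewrite /doob_cst ler_pdivlMr//; lra.
Qed.

(** The discrete Hoelder inequality in the shape needed to prove Minkowski's
    inequality by duality: a_i^(q-1) is the extremal test sequence. *)
Lemma hoelder_powR_sum (I : Type) (s : seq I) (a b : I -> R) :
  (forall i, 0 <= a i) -> (forall i, 0 <= b i) ->
  \sum_(i <- s) a i `^ (q - 1) * b i <=
  ((\sum_(i <- s) a i `^ q) `^ q^-1) `^ (q - 1) *
    (\sum_(i <- s) b i `^ q) `^ q^-1.
Proof.
move=> a0 b0.
have q0 : q != 0 by rewrite gt_eqF.
set SA := \sum_(i <- s) a i `^ q; set SB := \sum_(i <- s) b i `^ q.
set A := SA `^ q^-1; set B := SB `^ q^-1.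
have SA0 : 0 <= SA by apply: sumr_ge0 => i _; exact: powR_ge0.
have SB0 : 0 <= SB by apply: sumr_ge0 => i _; exact: powR_ge0.
have AE : A `^ q = SA by rewrite /A -powRrM mulVf// powRr1.
have BE : B `^ q = SB by rewrite /B -powRrM mulVf// powRr1.
have [SA_0|SA_n0] := eqVneq SA 0.
  suff -> : \sum_(i <- s) a i `^ (q - 1) * b i = 0.
    by rewrite mulr_ge0// powR_ge0.
  move: SA_0; rewrite /SA; elim: s {SA SB A B SA0 SB0 AE BE} => [|i s IH].
    by rewrite !big_nil.
  rewrite !big_cons => /eqP; rewrite paddr_eq0 ?powR_ge0 ?sumr_ge0//; last first.
    by move=> *; exact: powR_ge0.
  rewrite powR_eq0 => /andP[/andP[/eqP -> _] /eqP /IH ->].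
  by rewrite powR0 ?(gt_eqF q1_gt0)// mul0r addr0.
have [SB_0|SB_n0] := eqVneq SB 0.
  suff -> : \sum_(i <- s) a i `^ (q - 1) * b i = 0.
    by rewrite mulr_ge0// powR_ge0.
  move: SB_0; rewrite /SB; elim: s {SA SB A B SA0 SB0 AE BE SA_n0} => [|i s IH].
    by rewrite !big_nil.
  rewrite !big_cons => /eqP; rewrite paddr_eq0 ?powR_ge0 ?sumr_ge0//; last first.
    by move=> *; exact: powR_ge0.
  rewrite powR_eq0 => /andP[/andP[/eqP -> _] /eqP /IH ->].
  by rewrite mulr0 addr0.
have Agt0 : 0 < A by rewrite powR_gt0// lt_neqAle eq_sym SA_n0.
have Bgt0 : 0 < B by rewrite powR_gt0// lt_neqAle eq_sym SB_n0.
have An0 : A != 0 by exact: lt0r_neq0 Agt0.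
have Bn0 : B != 0 by exact: lt0r_neq0 Bgt0.
(* each term is bounded by Young's inequality for a_i / A and b_i / B *)
have term i : q * (a i `^ (q - 1) * b i) <=
    A `^ (q - 1) * B * ((q - 1) * (a i `^ q / SA) + b i `^ q / SB).
  clearbody A B SA SB.
  have aA : a i = A * (a i / A) by field.
  have bB : b i = B * (b i / B) by field.
  have aA0 : 0 <= a i / A by rewrite divr_ge0// ltW.
  have bB0 : 0 <= b i / B by rewrite divr_ge0// ltW.
  have E1 : a i `^ q / SA = (a i / A) `^ q.
    by rewrite {1}aA powRM ?(ltW Agt0)// AE; field.
  have E2 : b i `^ q / SB = (b i / B) `^ q.
    by rewrite {1}bB powRM ?(ltW Bgt0)// BE; field.
  rewrite E1 E2 {1}aA {1}bB powRM ?(ltW Agt0)//.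
  have := young_powR aA0 bB0; set u := _ `^ (q - 1); set v := b i / B.
  have AB0 : 0 <= A `^ (q - 1) * B by rewrite mulr_ge0 ?powR_ge0 ?(ltW Bgt0).
  move=> /(ler_wpM2l AB0) /le_trans -/(_ _ (lexx _)); apply: le_trans.
  by rewrite le_eqVlt; apply/orP; left; apply/eqP; ring.
rewrite -(ler_pM2l q_gt0) mulr_sumr.
apply: le_trans (ler_sum _ (fun i _ => term i)) _.
rewrite -mulr_sumr big_split/= -mulr_sumr -!mulr_suml -/SA -/SB !divff//.
by rewrite le_eqVlt; apply/orP; left; apply/eqP; ring.
Qed.

End powers.

(** * Powers and suprema of extended reals *)
Section epowers.
Context {R : realType}.
Local Open Scope ereal_scope.

Lemma poweR_le {r : R} {x y : \bar R} :
  (0 <= r)%R -> 0 <= x -> x <= y -> x `^ r <= y `^ r.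
Proof.
move=> r0 x0 xy; rewrite gt0_ler_poweR// in_itv/= leey andbT//.
exact: le_trans xy.
Qed.

Lemma poweRK {r : R} {x : \bar R} : r != 0%R -> 0 <= x -> (x `^ r) `^ r^-1 = x.
Proof. by move=> r0 x0; rewrite -poweRrM mulfV// poweRe1. Qed.

Lemma poweRVK {r : R} {x : \bar R} : r != 0%R -> 0 <= x -> (x `^ r^-1) `^ r = x.
Proof. by move=> r0 x0; rewrite -poweRrM mulVf// poweRe1. Qed.

Lemma add_poweR_sup_le {r : R} {a B : \bar R} {A : set (\bar R)} : (0 < r)%R ->
  0 <= a -> A !=set0 -> (forall v, A v -> 0 <= v) ->
  (forall v, A v -> a + v `^ r <= B) -> a + ereal_sup A `^ r <= B.
Proof.
move=> r0 a0 [v0 Av0] A0 h; have rn0 := lt0r_neq0 r0.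
have [->|Boo] := eqVneq B +oo; first by rewrite leey.
have aB : a <= B by apply: le_trans (h _ Av0); rewrite leeDl// poweR_ge0.
have Bfin : B \is a fin_num.
  by rewrite ge0_fin_numE ?(le_trans a0)// lt_neqAle Boo leey.
have afin : a \is a fin_num.
  by rewrite ge0_fin_numE// (le_lt_trans aB)// -ge0_fin_numE// (le_trans a0).
have c0 : 0 <= B - a by rewrite sube_ge0// afin.
rewrite -leeBrDl// -[leRHS](poweRVK rn0 c0); apply: poweR_le; first exact: ltW.
  by apply: le_trans (ereal_sup_ubound Av0); exact: A0.
apply: ub_ereal_sup => v Av; rewrite -[leLHS](poweRK rn0 (A0 _ Av)).
apply: poweR_le; rewrite ?invr_ge0 ?(ltW r0) ?poweR_ge0//.
by rewrite leeBrDl//; exact: h.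
Qed.

(** Suprema of independent choices can be taken one index at a time; the
    summand a carries the indices already treated. *)
Lemma sum_poweR_sup_le {r : R} {B : \bar R} {A : nat -> set (\bar R)} :
  (0 < r)%R -> (forall j, A j !=set0) -> (forall j v, A j v -> 0 <= v) ->
  forall J a, 0 <= a ->
  (forall y, (forall j, A j (y j)) -> a + \sum_(0 <= j < J) y j `^ r <= B) ->
  a + \sum_(0 <= j < J) ereal_sup (A j) `^ r <= B.
Proof.
move=> r0 An0 A0; elim=> [|J IH] a a0 h.
  have /choice[y hy] := An0.
  by rewrite big_geq//; have := h _ hy; rewrite big_geq.
rewrite big_nat_recr//= addeA addeAC; apply: IH.
  by rewrite adde_ge0 ?poweR_ge0.
move=> y hy; rewrite addeAC; apply: add_poweR_sup_le => //.
- by rewrite adde_ge0// sume_ge0// => j _; exact: poweR_ge0.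
- exact: A0.
move=> v Av; have := h (fun j => if j == J then v else y j).
rewrite big_nat_recr//= eqxx addeA.
rewrite (eq_big_nat _ _ (F2 := fun j => y j `^ r)) => [|j /andP[_ jJ]].
  by apply=> j; case: eqP => [->|].
by rewrite ltn_eqF.
Qed.

End epowers.

(** * Dyadic descendants of a cube *)
Lemma expr2_inj {R : realType} : injective (fun k => 2 ^+ k : R).
Proof.
by move=> d k /= h; apply/eqP; rewrite eqn_leq -!(@ler_eXn2l R 2) ?ltr1n// h lexx.
Qed.

Section descendants.
Context {R : realType} {n : nat}.
Implicit Types (P Q : cube R n) (x y : 'rV[R]_n).

Definition child_at P x : cube R n :=
  child P [ffun i => corner P 0 i + (side P)%:num / 2 <= x 0 i].

(** The d-th generation dyadic subcube of Q containing x, when x is in Q. *)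
Definition desc Q x d : cube R n := iter d (child_at^~ x) Q.

Lemma descS Q x d : desc Q x d.+1 = child_at (desc Q x d) x.
Proof. by []. Qed.

Lemma descD Q x d k : desc Q x (d + k) = desc (desc Q x d) x k.
Proof. by rewrite /desc addnC iterD. Qed.

Lemma desc_child_at Q x d : desc (child_at Q x) x d = desc Q x d.+1.
Proof. by rewrite /desc iterSr. Qed.

Lemma child_sub Q e : cube_set (child Q e) `<=` cube_set Q.
Proof.
move=> x /= h i; move: (h i); rewrite mxE.
have s0 : 0 < (side Q)%:num by [].
by case: (e i); rewrite /= ?mulr1n ?mulr0n ?mul1r ?mul0r;
move=> /andP[h1 h2]; apply/andP; split; lra.
Qed.

Lemma child_choice {P e x} : cube_set (child P e) x ->
  e = [ffun i => corner P 0 i + (side P)%:num / 2 <= x 0 i].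
Proof.
move=> h; apply/ffunP => i; rewrite ffunE.
move: (h i); rewrite mxE /=; have s0 : 0 < (side P)%:num by [].
case: (e i); rewrite /= ?mulr1n ?mulr0n ?mul1r ?mul0r => /andP[h1 h2].
  by rewrite h1.
by apply/esym/negbTE; rewrite -ltNge; lra.
Qed.

Lemma child_at_child {P e x} : cube_set (child P e) x -> child_at P x = child P e.
Proof. by move=> /child_choice ->. Qed.

Lemma mem_child_at P x : cube_set P x -> cube_set (child_at P x) x.
Proof.
move=> h i; rewrite mxE ffunE /=; have := h i.
have s0 : 0 < (side P)%:num by [].
by case: (leP (corner P 0 i + (side P)%:num / 2) (x 0 i)) => c;
rewrite /= ?mulr1n ?mulr0n ?mul1r ?mul0r;
move=> /andP[h1 h2]; apply/andP; split; lra.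
Qed.

Lemma mem_desc {Q x} d : cube_set Q x -> cube_set (desc Q x d) x.
Proof. by move=> Qx; elim: d => [//|d IH]; rewrite descS; exact: mem_child_at. Qed.

Lemma desc_sub Q x d k : cube_set (desc Q x (d + k)) `<=` cube_set (desc Q x d).
Proof.
elim: k => [|k IH]; first by rewrite addn0.
by rewrite addnS descS; apply: subset_trans IH; exact: child_sub.
Qed.

Lemma desc_grid Q x d : dyadic_grid Q (desc Q x d).
Proof.
elim: d => [|d IH]; first exact: dyadic_grid_refl.
by rewrite descS; exact: dyadic_grid_child.
Qed.

Lemma dyadic_grid_trans Q1 Q2 Q3 :
  dyadic_grid Q1 Q2 -> dyadic_grid Q2 Q3 -> dyadic_grid Q1 Q3.
Proof. by move=> h; elim=> // P e _; exact: dyadic_grid_child. Qed.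

Lemma desc_eq {Q x y d} : cube_set (desc Q y d) x -> desc Q x d = desc Q y d.
Proof.
elim: d => [//|d IH]; rewrite !descS => h.
by rewrite IH; [exact: child_at_child h|exact: child_sub h].
Qed.

Lemma desc_eq_le {Q x y d k} :
  (k <= d)%N -> cube_set (desc Q y d) x -> desc Q x k = desc Q y k.
Proof. by move=> /subnKC <- /desc_sub; exact: desc_eq. Qed.

Lemma side_desc Q x d : (side (desc Q x d))%:num = (side Q)%:num / 2 ^+ d.
Proof.
elim: d => [|d IH]; first by rewrite expr0 divr1.
by rewrite descS /= IH exprS invfM mulrA mulrAC.
Qed.

Lemma desc_inj {Q x} : injective (desc Q x).
Proof.
move=> d k /(congr1 (fun P => (side P)%:num)); rewrite !side_desc.
have sn0 : (side Q)%:num != 0 by rewrite gt_eqF.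
by move=> /(mulfI sn0)/invr_inj; exact: expr2_inj.
Qed.

Lemma corner_desc Q x d i :
  exists m : nat, corner (desc Q x d) 0 i =
    corner Q 0 i + (side Q)%:num / 2 ^+ d * m%:R.
Proof.
elim: d => [|d [m IH]]; first by exists 0%N; rewrite mulr0 addr0.
exists (m.*2 + (corner (desc Q x d) 0 i + (side (desc Q x d))%:num / 2 <= x 0 i)%R)%N.
rewrite descS mxE ffunE IH side_desc -!addrA; congr (_ + _).
rewrite natrD -muln2 natrM exprS invfM.
by field; rewrite expf_neq0 ?pnatr_eq0.
Qed.

End descendants.

(** * Dyadic lattices generated by shifted chains *)
Section chain.
Context {R : realType} {n : nat}.
Implicit Types (b : {ffun 'I_n -> bool}) (x : 'rV[R]_n).

(** The origin divides each side of [chain b N] in the ratio 1:2 or 2:1, in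
    alternation with N.  So each cube is a child of the following one, and
    since the origin stays a fixed proportion away from the boundary the cubes
    exhaust the space.  The bit b i chooses the phase in coordinate i. *)
Definition chain b N : cube R n :=
  Cube (\row_i (- (2 ^+ N * (if odd N (+) b i then 3^-1 else 2 / 3))))
       (2 ^+ N)%:pos.

Lemma chain_child b N :
  chain b N = child (chain b N.+1) [ffun i => odd N (+) b i].
Proof.
rewrite /chain /child; congr Cube; last first.
  by apply/val_inj => /=; rewrite exprS mulrC mulKf.
apply/rowP => i; rewrite !mxE ffunE /= addNb.
by case: (odd N (+) b i) => /=; rewrite exprS; field.
Qed.

Lemma chain_desc {b N M x} : cube_set (chain b N) x ->
  cube_set (chain b (N + M)) x /\ desc (chain b (N + M)) x M = chain b N.
Proof.
move=> xN; elim: M => [|M [IH1 IH2]]; first by rewrite addn0.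
have h : cube_set (child (chain b (N + M).+1) [ffun i => odd (N + M) (+) b i]) x.
  by rewrite -chain_child.
rewrite addnS; split; first exact: child_sub h.
have := descD (chain b (N + M).+1) x 1 M; rewrite add1n => ->.
by rewrite descS (child_at_child h) -chain_child.
Qed.

Lemma chain_desc_le {b N M x} : (N <= M)%N -> cube_set (chain b N) x ->
  cube_set (chain b M) x /\ desc (chain b M) x (M - N) = chain b N.
Proof. by move=> NM; have := @chain_desc b N (M - N) x; rewrite subnKC. Qed.

Lemma chain_inj b : injective (chain b).
Proof. by move=> N M /(congr1 (fun P => (side P)%:num)); exact: expr2_inj. Qed.

Lemma chain_grid b N M : (N <= M)%N -> dyadic_grid (chain b M) (chain b N).
Proof.
move=> /subnKC <-; elim: (M - N)%N => [|k IH].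
  by rewrite addn0; exact: dyadic_grid_refl.
apply: dyadic_grid_trans IH; rewrite addnS (chain_child b (N + k)).
exact/dyadic_grid_child/dyadic_grid_refl.
Qed.

Lemma chain_cover (r : R) : exists N, forall b x,
  (forall i, `|x 0 i| <= r) -> cube_set (chain b N) x.
Proof.
exists (truncn (3 * r)).+1 => b x h i.
set N := (truncn (3 * r)).+1.
have rN : 3 * r < 2 ^+ N.
  apply: (lt_trans (truncnS_gt _)); rewrite -natrX ltr_nat; exact: ltn_expl.
have := h i; rewrite ler_norml mxE /= => /andP[h1 h2].
by case: (_ (+) _); apply/andP; split; lra.
Qed.

Lemma normr_coor_le x i : `|x 0 i| <= `|x|.
Proof.
rewrite -[`|x|]/(mx_norm x) mx_normrE.
exact: (le_bigmax _ (fun ij => `|x ij.1 ij.2|) (0, i)).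
Qed.

Lemma chain_cover_pt x :
  exists N0, forall N b, (N0 <= N)%N -> cube_set (chain b N) x.
Proof.
have [N0 hN0] := chain_cover `|x|; exists N0 => N b NN.
by apply: (chain_desc_le NN _).1; apply: hN0 => i; exact: normr_coor_le.
Qed.

Definition lattice b : set (cube R n) :=
  [set P | exists N, dyadic_grid (chain b N) P].

Lemma lattice_dyadic b : dyadic_lattice (lattice b).
Proof.
split=> [Q [N QN] P QP|Q1 Q2 [N1 h1] [N2 h2]|K cK].
- by exists N; exact: dyadic_grid_trans QP.
- exists (chain b (maxn N1 N2)); split.
  + by exists (maxn N1 N2); exact: dyadic_grid_refl.
  + by apply: dyadic_grid_trans h1; exact/chain_grid/leq_maxl.
  + by apply: dyadic_grid_trans h2; exact/chain_grid/leq_maxr.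
- have [r [_ Kr]] := compact_bounded cK.
  have [N hN] := chain_cover (r + 1); exists (chain b N).
    by exists N; exact: dyadic_grid_refl.
  move=> x Kx; apply: hN => i.
  apply: le_trans (Kr (r + 1) (ltr_pwDr ltr01 (lexx r)) x Kx).
  exact: normr_coor_le.
Qed.

End chain.
Section cover.
Context {R : realType} {n : nat}.

(** A power of 2 is not a multiple of 3: this separates the grids of the two
    phases, which differ by a third of the side of a large cube. *)
Lemma thirds_apart (d : nat) (w : int) (t : bool) :
  1 <= `|(if t then 1 else - 1) * 2 ^+ d + 3 * w%:~R| :> R.
Proof.
have -> : (if t then 1 else - 1) * 2 ^+ d + 3 * w%:~R =
    ((if t then 1 else - 1) * 2 ^+ d + 3 * w)%:~R :> R.
  by rewrite rmorphD !rmorphM /= rmorphXn /=; case: t; rewrite ?rmorphN1.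
rewrite -intr_norm ler1z; set v := (_ + _ : int).
suff v0 : v != 0 by rewrite -[1]/(1%:Z) lez_nat absz_gt0.
apply/eqP => /eqP; rewrite addr_eq0 => /eqP /(congr1 absz).
rewrite abszM abszN abszM abszX.
have -> : absz (if t then 1 else - 1) = 1%N by case: (t).
rewrite mul1n /= => h.
have : (3 %| 2 ^ d)%N by rewrite h dvdn_mulr.
by case: d {v h} => // d; rewrite Euclid_dvdX.
Qed.

(** At a scale larger than three times the side of Q, an edge of Q cannot
    contain endpoints of the grids of both phases in its interior; in each
    coordinate pick a phase without such an endpoint. *)
Lemma cube_cover (Q : cube R n) (x : 'rV[R]_n) : cube_set Q x ->
  exists N0, forall N, (N0 <= N)%N ->
    exists b d, cube_set Q `<=` cube_set (desc (chain b N) x d) /\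
    (side (desc (chain b N) x d))%:num <= 6 * (side Q)%:num.
Proof.
move=> Qx; have : 0 < (side Q)%:num by [].
set l := (side Q)%:num => l0.
have [N1 hN1] := chain_cover_pt x.
exists (maxn N1 (truncn (3 * l)).+1) => N; rewrite geq_max => /andP[N1N N2N].
have bx b : cube_set (chain b N) x.
  exact: hN1.
have lN : 3 * l < 2 ^+ N.
  apply: (lt_trans (truncnS_gt _)); rewrite -natrX ltr_nat.
  exact: leq_ltn_trans N2N (ltn_expl _ _).
(* d is the greatest depth at which the side still exceeds 3 l *)
have [d dP dmin] : exists2 d, 2 ^+ N / 2 ^+ d.+1 <= 3 * l
    & forall k, 2 ^+ N / 2 ^+ k.+1 <= 3 * l -> (d <= k)%N.
  have ex : exists d, 2 ^+ N / 2 ^+ d.+1 <= 3 * l.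
    exists (truncn (2 ^+ N / (3 * l))).
    rewrite ler_pdivrMr ?exprn_gt0// mulrC -ler_pdivrMr ?mulr_gt0//.
    apply: (le_trans (ltW (truncnS_gt _))).
    by move: (truncn _) => k; rewrite -natrX ler_nat; exact/ltnW/ltn_expl.
  by case: (ex_minnP ex) => d ? ?; exists d.
pose s : R := 2 ^+ N / 2 ^+ d.
have s0 : 0 < s by rewrite divr_gt0 ?exprn_gt0.
have sl : 3 * l < s.
  rewrite /s; case: d {s s0} dP dmin => [|d] dP dmin; first by rewrite divr1.
  by rewrite ltNge; apply/negP => /dmin; rewrite ltnn.
have sl6 : s <= 6 * l.
  move: dP; rewrite exprS invfM mulrCA -/s; lra.
pose c (t : bool) : R := if odd N (+) t then 3^-1 else 2 / 3.
pose a i := corner Q 0 i.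
(* an endpoint of the grid of phase t falls inside the i-th edge of Q *)
pose hit i t := exists z : int, a i < - (2 ^+ N * c t) + s * z%:~R < a i + l.
have hit1 i : ~ (hit i false /\ hit i true).
  move=> [[z /andP[z1 z2]] [w /andP[w1 w2]]].
  have E : 2 ^+ N = s * 2 ^+ d by rewrite /s divfK// expf_neq0// pnatr_eq0.
  have := thirds_apart d (w - z) (~~ odd N).
  have -> : (if ~~ odd N then 1 else - 1) * 2 ^+ d + 3 * (w - z)%:~R =
      3 / s * ((- (2 ^+ N * c true) + s * w%:~R) -
               (- (2 ^+ N * c false) + s * z%:~R)).
    rewrite E /c rmorphB /=; case: (odd N) => /=; field; exact: lt0r_neq0.
  rewrite normrM (gtr0_norm (divr_gt0 _ _))// mulrAC ler_pdivlMr// mul1r.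
  apply/negP; rewrite -ltNge; apply: lt_trans sl.
  by rewrite ltr_pM2l// ltr_norml; apply/andP; split; lra.
pose b : {ffun 'I_n -> bool} := [ffun i => `[< hit i false >]].
have nohit i : ~ hit i (b i).
  rewrite ffunE; case: asboolP => // h h'; exact: (hit1 i).
have sE : (side (desc (chain b N) x d))%:num = s by rewrite side_desc.
exists b, d; split; last by rewrite sE.
move=> y Qy i; have [m pE] := corner_desc (chain b N) x d i.
have := mem_desc d (bx b) i; have := Qx i; have := Qy i.
rewrite sE; move: pE; rewrite mxE -/s -/(c (b i)) -/(a i) -/l.
move=> pE /andP[y1 y2] /andP[x1 x2] /andP[p1 p2].
set p := corner _ 0 i in pE p1 p2 *.
have pa : p <= a i.
  rewrite leNgt; apply/negP => ap; apply: (nohit i); exists m%:Z.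
  by rewrite -pE ap /= (le_lt_trans p1).
have pal : a i + l <= p + s.
  rewrite leNgt; apply/negP => ap; apply: (nohit i); exists (m%:Z + 1).
  have -> : - (2 ^+ N * c (b i)) + s * (m%:Z + 1)%:~R = p + s.
    by rewrite pE intrD mulrDr mulr1 addrA.
  by rewrite ap andbT (le_lt_trans x1).
by apply/andP; split; lra.
Qed.

End cover.

(** * Averages over cubes *)
Section averages.
Context {R : realType} {n : nat}.
Implicit Types (Q P : cube R n) (h : Rn R n -> \bar R).
Local Open Scope ereal_scope.

Lemma measurable_cube Q : measurable (cube_set Q).
Proof.
apply: sub_caratheodory; apply: sub_sigma_algebra.
exact: (measurable_box (corner Q) (side Q)%:num).
Qed.
Hint Resolve measurable_cube : core.

Lemma avgE h Q : avg h Q =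
  ((side Q)%:num ^+ n)^-1%:E * \int[@leb R n]_(y in cube_set Q) h y.
Proof. by rewrite /avg leb_cube inver expf_eq0 gt_eqF// andbF. Qed.

Lemma avg_ge0 h Q : (forall x, 0 <= h x) -> 0 <= avg h Q.
Proof.
move=> h0; rewrite avgE mule_ge0 ?integral_ge0// lee_fin invr_ge0 exprn_ge0//.
Qed.

Lemma le_avg h1 h2 Q : measurable_fun setT h1 -> measurable_fun setT h2 ->
  (forall x, 0 <= h1 x) -> (forall x, h1 x <= h2 x) -> avg h1 Q <= avg h2 Q.
Proof.
move=> m1 m2 h10 h12; rewrite !avgE lee_wpmul2l ?lee_fin ?invr_ge0 ?exprn_ge0//.
apply: ge0_le_integral => //; exact: measurable_funTS.
Qed.

Lemma avg_sum (h_ : nat -> Rn R n -> \bar R) (k_ : nat -> R) (s : seq nat) Q :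
  (forall j, measurable_fun setT (h_ j)) -> (forall j x, 0 <= h_ j x) ->
  (forall j, (0 <= k_ j)%R) ->
  avg (fun x => \sum_(j <- s) (k_ j)%:E * h_ j x) Q =
  \sum_(j <- s) (k_ j)%:E * avg (h_ j) Q.
Proof.
move=> mh h0 k0; rewrite avgE ge0_integral_sum//; last 2 first.
- by move=> j; apply/measurable_funTS/measurable_funeM.
- by move=> j x _; rewrite mule_ge0// lee_fin.
rewrite ge0_sume_distrr; last first.
  by move=> j _; apply: integral_ge0 => x _; rewrite mule_ge0// lee_fin.
apply: eq_bigr => j _.
rewrite avgE muleCA; congr (_ * _).
apply: (@ge0_integralZl _ _ _ (@leb R n) _ (measurable_cube Q)).
- exact: measurable_funTS.
- by [].
- by rewrite lee_fin.
Qed.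

Lemma avg_dilate {c : R} {h P Q} :
  measurable_fun setT h -> (forall x, 0 <= h x) ->
  cube_set Q `<=` cube_set P -> ((side P)%:num <= c * (side Q)%:num)%R ->
  avg h Q <= (c ^+ n)%:E * avg h P.
Proof.
move=> mh h0 QP PQ; rewrite !avgE muleA -EFinM.
apply: (@le_trans _ _ (((side Q)%:num ^+ n)^-1%:E *
    \int[@leb R n]_(y in cube_set P) h y)).
  rewrite lee_wpmul2l ?lee_fin ?invr_ge0 ?exprn_ge0//.
  by apply: ge0_subset_integral => //; exact: measurable_funTS.
rewrite lee_wpmul2r ?integral_ge0// lee_fin.
rewrite ler_pdivlMr ?exprn_gt0// mulrC ler_pdivrMr ?exprn_gt0//.
have c0 : (0 <= c)%R by rewrite -(@pmulr_lge0 _ (side Q)%:num)// (le_trans _ PQ).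
by rewrite -exprMn lerXn2r// nnegrE ?mulr_ge0.
Qed.

Lemma cube_children P :
  cube_set P = \big[setU/set0]_(e : {ffun 'I_n -> bool}) cube_set (child P e).
Proof.
rewrite -bigcup_seq; apply/seteqP; split=> [x Px|x [e _]]; last first.
  exact: child_sub.
by eexists; last exact: mem_child_at Px; exact: mem_index_enum.
Qed.

Lemma avg_children h P : measurable_fun setT h -> (forall x, 0 <= h x) ->
  avg h P = (2 ^- n)%:E * \sum_(e : {ffun 'I_n -> bool}) avg h (child P e).
Proof.
move=> mh h0; rewrite avgE {1}cube_children.
rewrite (@ge0_integral_bigsetU _ _ _ (@leb R n)) => //; last 3 first.
- exact: index_enum_uniq.
- by move=> e e' _ _ [x [/= /child_choice -> /child_choice ->]].
- exact: measurable_funTS.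
rewrite !ge0_sume_distrr//; last 2 first.
- by move=> e _; exact: avg_ge0.
- by move=> e _; exact: integral_ge0.
apply: eq_bigr => e _; rewrite avgE muleA -EFinM; congr (_%:E * _).
by rewrite /= expr_div_n; field; rewrite !expf_neq0.
Qed.

End averages.

Definition absf {R : realType} {n : nat} (f : nat -> Rn R n -> R) j (x : Rn R n) :
  \bar R := `|f j x|%:E.

Section vector_averages.
Context {R : realType} {n : nat} {q : R}.
Hypothesis q_gt1 : (1 < q)%R.
Context {f : nat -> Rn R n -> R}.
Hypothesis mf : forall j, measurable_fun setT (f j).
Implicit Types (Q P : cube R n).
Local Open Scope ereal_scope.

Local Notation absf := (absf f).
Let q_gt0 : (0 < q)%R. Proof. exact: lt_trans q_gt1. Qed.
Let q_neq0 : q != 0%R. Proof. exact: lt0r_neq0. Qed.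

Lemma absf_ge0 j x : 0 <= absf j x.
Proof. by rewrite lee_fin. Qed.

Lemma measurable_absf j : measurable_fun setT (absf j).
Proof. by apply/measurable_EFinP; exact: measurableT_comp. Qed.

Lemma lq_norm_ge0 x : 0 <= lq_norm q f x.
Proof. exact: poweR_ge0. Qed.

Lemma measurable_lq_norm : measurable_fun setT (lq_norm q f).
Proof.
rewrite /lq_norm.
apply: (measurableT_comp (measurable_poweR _)).
apply: ge0_emeasurable_sum => [j x _ _|j _]; first exact: poweR_ge0.
by apply: (measurableT_comp (measurable_poweR _)); exact: measurable_absf.
Qed.

Lemma lq_norm_ge_sum J x :
  ((\sum_(0 <= j < J) `|f j x| `^ q) `^ q^-1)%:E <= lq_norm q f x.
Proof.
rewrite -poweR_EFin /lq_norm gt0_ler_poweR ?invr_ge0 ?(ltW q_gt0)//.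
- by rewrite in_itv/= leey andbT lee_fin sumr_ge0// => j _; exact: powR_ge0.
- by rewrite in_itv/= leey andbT nneseries_ge0// => *; exact: poweR_ge0.
rewrite -sumEFin.
apply: (@nneseries_lim_ge _ (fun j => `|f j x|%:E `^ q)) => j _ _.
exact: poweR_ge0.
Qed.

Lemma absf_le_lq_norm j x : absf j x <= lq_norm q f x.
Proof.
apply: le_trans (lq_norm_ge_sum j.+1 x); rewrite lee_fin big_nat_recr//=.
rewrite -{1}(powRr1 (normr_ge0 (f j x))) -{1}(mulfV q_neq0) powRrM.
rewrite ge0_ler_powR ?invr_ge0 ?(ltW q_gt0)// ?nnegrE ?powR_ge0//.
  by rewrite addr_ge0 ?powR_ge0// sumr_ge0// => i _; exact: powR_ge0.
by rewrite lerDr sumr_ge0// => i _; exact: powR_ge0.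
Qed.

Lemma avg_absf_ge0 j Q : 0 <= avg (absf j) Q.
Proof. exact/avg_ge0/absf_ge0. Qed.

Lemma avg_lq_norm_ge0 Q : 0 <= avg (lq_norm q f) Q.
Proof. exact/avg_ge0/lq_norm_ge0. Qed.

Lemma avg_absf_le j Q : avg (absf j) Q <= avg (lq_norm q f) Q.
Proof.
apply: le_avg; [exact: measurable_absf|exact: measurable_lq_norm| |].
- exact: absf_ge0.
- exact: absf_le_lq_norm.
Qed.

(** Minkowski's inequality for averages: test the averages a_j of |f_j| against
    a_j^(q-1), exchange the sum and the average, and use Hoelder's inequality
    pointwise. *)
Lemma avg_minkowski J Q :
  \sum_(0 <= j < J) avg (absf j) Q `^ q <= avg (lq_norm q f) Q `^ q.
Proof.
have [->|Foo] := eqVneq (avg (lq_norm q f) Q) +oo.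
  by rewrite poweRyr// leey.
have Ffin : avg (lq_norm q f) Q \is a fin_num.
  by rewrite ge0_fin_numE ?avg_lq_norm_ge0// lt_neqAle Foo leey.
have afin j : avg (absf j) Q \is a fin_num.
  rewrite ge0_fin_numE ?avg_absf_ge0// (le_lt_trans (avg_absf_le j Q))//.
  by rewrite -ge0_fin_numE ?avg_lq_norm_ge0.
pose a j := fine (avg (absf j) Q); pose V := fine (avg (lq_norm q f) Q).
have aE j : avg (absf j) Q = (a j)%:E by rewrite fineK.
have VE : avg (lq_norm q f) Q = V%:E by rewrite fineK.
have a0 j : (0 <= a j)%R by rewrite fine_ge0 ?avg_absf_ge0.
have V0 : (0 <= V)%R by rewrite fine_ge0 ?avg_lq_norm_ge0.
rewrite VE poweR_EFin; under eq_bigr do rewrite aE poweR_EFin.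
rewrite sumEFin lee_fin.
set S := (\sum_(0 <= j < J) a j `^ q)%R.
have S0 : (0 <= S)%R by apply: sumr_ge0 => j _; exact: powR_ge0.
set A := (S `^ q^-1)%R.
have A0 : (0 <= A)%R by exact: powR_ge0.
have AE : (A `^ q = S)%R by rewrite /A -powRrM mulVf// powRr1.
have key : (A `^ (q - 1) * A <= A `^ (q - 1) * V)%R.
  rewrite powRB1_mull// AE -lee_fin EFinM -VE.
  have -> : S%:E = \sum_(0 <= j < J) (a j `^ (q - 1))%:E * avg (absf j) Q.
    rewrite /S -sumEFin; apply: eq_bigr => j _.
    by rewrite aE -EFinM powRB1_mull.
  rewrite -avg_sum; [|exact: measurable_absf|exact: absf_ge0|]; last first.
    by move=> j; exact: powR_ge0.
  have -> : (A `^ (q - 1))%:E * avg (lq_norm q f) Q =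
      avg (fun x => \sum_(j <- [:: 0%N]) (A `^ (q - 1))%:E * lq_norm q f x) Q.
    rewrite (@avg_sum _ _ (fun=> lq_norm q f) (fun=> (A `^ (q - 1))%R)) ?big_seq1//.
    - by move=> _; exact: measurable_lq_norm.
    - by move=> _; exact: lq_norm_ge0.
    - by move=> _; exact: powR_ge0.
  apply: le_avg.
  - apply: emeasurable_sum => j; apply: measurable_funeM; exact: measurable_absf.
  - apply: emeasurable_sum => j; apply: measurable_funeM; exact: measurable_lq_norm.
  - move=> x; apply: sume_ge0 => j _.
    by rewrite mule_ge0 ?absf_ge0// lee_fin powR_ge0.
  - move=> x; rewrite big_seq1.
    apply: (@le_trans _ _ ((A `^ (q - 1))%:E *
        ((\sum_(0 <= j < J) `|f j x| `^ q) `^ q^-1)%:E)).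
      have -> : \sum_(0 <= j < J) (a j `^ (q - 1))%:E * absf j x =
          (\sum_(0 <= j < J) a j `^ (q - 1) * `|f j x|)%:E by rewrite -sumEFin.
      rewrite -EFinM lee_fin.
      exact: (hoelder_powR_sum q q_gt1 _ (index_iota 0 J) a (fun j => `|f j x|%R) a0).
    by rewrite lee_wpmul2l ?lq_norm_ge_sum// lee_fin powR_ge0.
rewrite -AE; have [->|An0] := eqVneq A 0%R.
  by rewrite powR0// powR_ge0.
rewrite ge0_ler_powR ?nnegrE ?(ltW q_gt0)//.
by move: key; rewrite ler_pM2l// powR_gt0// lt_neqAle eq_sym An0.
Qed.

End vector_averages.

(** * The local weak type inequality *)
Lemma measure_bigsetU_le {d} {T : measurableType d} {R : realType}
    (mu : {measure set T -> \bar R}) (I : Type) (s : seq I) (A : I -> set T) :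
  (forall i, measurable (A i)) ->
  (mu (\big[setU/set0]_(i <- s) A i) <= \sum_(i <- s) mu (A i))%E.
Proof.
move=> mA; elim: s => [|i s IH]; first by rewrite !big_nil measure0.
rewrite !big_cons; apply: (le_trans (measureU2 _ (mA i) _)).
  exact: bigsetU_measurable.
exact: leeD2l.
Qed.

Section weak_type.
Context {R : realType} {n : nat} {q : R}.
Hypothesis q_gt1 : 1 < q.
Variable f : nat -> Rn R n -> R.
Hypothesis mf : forall j, measurable_fun setT (f j).
Implicit Types (h : Rn R n -> \bar R) (Q P : cube R n) (M : nat -> R) (x : 'rV[R]_n).

Let q_gt0 : 0 < q. Proof. exact: lt_trans q_gt1. Qed.
Let q1_gt0 : 0 < q - 1. Proof. by rewrite subr_gt0. Qed.

Local Notation F := (lq_norm q f).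
Local Notation absf := (absf f).

Lemma side_child_pow P e :
  (side (child P e))%:num ^+ n = (side P)%:num ^+ n * 2 ^- n.
Proof. by rewrite /= expr_div_n. Qed.

Lemma avg_child_le {h P} e : measurable_fun setT h ->
  (forall x, (0 <= h x)%E) ->
  (avg h (child P e) <= (2 ^+ n)%:E * avg h P)%E.
Proof.
move=> mh h0; apply: (avg_dilate mh h0); first exact: child_sub.
by rewrite /= mulrC divfK.
Qed.

Lemma avg_child_fin {h P} e : measurable_fun setT h ->
  (forall x, (0 <= h x)%E) -> avg h P \is a fin_num ->
  avg h (child P e) \is a fin_num.
Proof.
move=> mh h0; rewrite !ge0_fin_numE ?avg_ge0// => hP.
by rewrite (le_lt_trans (avg_child_le e mh h0))//
  lte_mul_pinfty// ?avg_ge0// lee_fin exprn_ge0.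
Qed.

Definition lqavg P : R := fine (avg F P).
Definition favg j P : R := fine (avg (absf j) P).

Let mF : measurable_fun setT F. Proof. exact: measurable_lq_norm. Qed.
Let ma j : measurable_fun setT (absf j). Proof. exact: measurable_absf. Qed.

Lemma favg_ge0 j P : 0 <= favg j P.
Proof. by rewrite fine_ge0 ?avg_absf_ge0. Qed.

Lemma lqavg_ge0 P : 0 <= lqavg P.
Proof. by rewrite fine_ge0 ?avg_lq_norm_ge0. Qed.

Section finite_cube.
Variable P : cube R n.
Hypothesis Pfin : avg F P \is a fin_num.

Lemma avg_absf_fin j : avg (absf j) P \is a fin_num.
Proof.
rewrite ge0_fin_numE ?avg_absf_ge0//; apply: le_lt_trans (avg_absf_le q_gt1 mf j P) _.
by rewrite -ge0_fin_numE ?avg_lq_norm_ge0.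
Qed.

Lemma lqavgE : avg F P = (lqavg P)%:E. Proof. by rewrite fineK. Qed.

Lemma favgE j : avg (absf j) P = (favg j P)%:E.
Proof. by rewrite fineK ?avg_absf_fin. Qed.

Lemma minkowski_favg J : \sum_(0 <= j < J) favg j P `^ q <= lqavg P `^ q.
Proof.
rewrite -lee_fin -poweR_EFin -lqavgE; apply: le_trans (avg_minkowski q_gt1 mf J P).
rewrite -sumEFin le_eqVlt; apply/orP; left; apply/eqP.
by apply: eq_bigr => j _; rewrite favgE poweR_EFin.
Qed.

Lemma avg_child_lq_fin e : avg F (child P e) \is a fin_num.
Proof. by apply: avg_child_fin => //; exact: lq_norm_ge0. Qed.

Lemma lqavg_child_le e : lqavg (child P e) <= 2 ^+ n * lqavg P.
Proof.
rewrite -lee_fin EFinM -lqavgE /lqavg fineK ?avg_child_lq_fin//.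
by apply: avg_child_le => //; exact: lq_norm_ge0.
Qed.

End finite_cube.

Lemma fine_avg_children h P : measurable_fun setT h ->
  (forall x, (0 <= h x)%E) -> avg h P \is a fin_num ->
  fine (avg h P) = \sum_(e : {ffun 'I_n -> bool}) 2 ^- n * fine (avg h (child P e)).
Proof.
move=> mh h0 hP; apply: EFin_inj; rewrite fineK// avg_children//.
rewrite -sumEFin ge0_sume_distrr; last by move=> e _; exact: avg_ge0.
by apply: eq_bigr => e _; rewrite EFinM fineK// avg_child_fin.
Qed.

Section bellman.
Variables (J : nat) (lam t : R).
Hypotheses (lam_gt0 : 0 < lam) (t_gt0 : 0 < t).

Definition bellman_cst : R := doob_cst q `^ q * (2 ^+ n) `^ (q - 1).

(** An upper bound for the proportion of P where either some average of F
    exceeds lam, or the q-th powers of the running maxima started from M sum to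
    more than t.  The first term is Markov's inequality for averages of F, the
    second one Doob's inequality where these averages stay below lam. *)
Definition bellman P M : R := lqavg P / lam +
  (bellman_cst * lam `^ (q - 1) * lqavg P +
   \sum_(0 <= j < J) doob_fun q (M j) (favg j P)) / t.

Lemma sum_children_const (c : R) :
  \sum_(e : {ffun 'I_n -> bool}) 2 ^- n * c = c.
Proof.
rewrite sumr_const card_ffun card_bool card_ord -[_ *+ (2 ^ n)]mulr_natl natrX mulrA.
by rewrite mulfV ?mul1r// expf_neq0.
Qed.

(** With M fixed, [bellman] is affine in the averages over P. *)
Lemma bellman_children P M : avg F P \is a fin_num ->
  bellman P M = \sum_(e : {ffun 'I_n -> bool}) 2 ^- n * bellman (child P e) M.
Proof.
move=> Pfin.
have lqE : lqavg P = \sum_(e : {ffun 'I_n -> bool}) 2 ^- n * lqavg (child P e).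
  by apply: fine_avg_children => //; exact: lq_norm_ge0.
have fE j : favg j P = \sum_(e : {ffun 'I_n -> bool}) 2 ^- n * favg j (child P e).
  apply: fine_avg_children => //; first exact: absf_ge0.
  exact: avg_absf_fin.
have term e : 2 ^- n * bellman (child P e) M =
    (2 ^- n * lqavg (child P e)) / lam +
    (bellman_cst * lam `^ (q - 1) * (2 ^- n * lqavg (child P e)) +
     \sum_(0 <= j < J) 2 ^- n * doob_fun q (M j) (favg j (child P e))) / t.
  rewrite -mulr_sumr /bellman; move: (\sum_(_ <= _ < _) _) => S.
  by move: (lam^-1) (t^-1) (2 ^- n) => u v c; ring.
rewrite (eq_bigr _ (fun e _ => term e)) big_split/= -!mulr_suml big_split/=.
rewrite -lqE -mulr_sumr -lqE exchange_big/= /bellman; congr (_ + (_ + _) / _).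
apply: eq_bigr => j _; rewrite /doob_fun fE.
rewrite -{1}(sum_children_const (2 * M j `^ q)) !mulr_sumr -sumrB.
by apply: eq_bigr => e _; ring.
Qed.

(** The term in lam absorbs the q-th powers of the averages of the f_j: their
    sum is at most lqavg P ^ q by Minkowski's inequality, hence a multiple of
    lqavg P.  The factor 2 ^+ n allows P to be the first cube where the average
    of F exceeds lam. *)
Lemma bellman_ge P M : avg F P \is a fin_num -> lqavg P <= 2 ^+ n * lam ->
  (forall j, 0 <= M j) ->
  \sum_(0 <= j < J) M j `^ q <=
  bellman_cst * lam `^ (q - 1) * lqavg P +
   \sum_(0 <= j < J) doob_fun q (M j) (favg j P).
Proof.
move=> Pfin Plam M0.
apply: (@le_trans _ _ (\sum_(0 <= j < J)
    (doob_cst q `^ q * favg j P `^ q + doob_fun q (M j) (favg j P)))).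
  by apply: ler_sum => j _; apply: doob_fun_leaf => //; exact: favg_ge0.
rewrite big_split/= lerD2r -mulr_sumr /bellman_cst -!mulrA.
rewrite ler_wpM2l ?powR_ge0//.
apply: (le_trans (minkowski_favg _ Pfin _)).
rewrite -(powRB1_mull _ q_gt1 (lqavg_ge0 _)) mulrA ler_wpM2r ?lqavg_ge0//.
rewrite -powRM ?exprn_ge0 ?(ltW lam_gt0)//.
rewrite ge0_ler_powR ?nnegrE ?(ltW q1_gt0) ?lqavg_ge0//.
by rewrite mulr_ge0 ?exprn_ge0 ?(ltW lam_gt0).
Qed.

Fixpoint rmax M P x d : nat -> R :=
  if d is d'.+1 then fun j => Num.max (rmax M P x d' j) (favg j (desc P x d))
  else M.

Lemma rmax_child_at M P x d : rmax M P x d.+1 =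
  rmax (fun j => Num.max (M j) (favg j (child_at P x))) (child_at P x) x d.
Proof.
elim: d => [//|d IH].
rewrite -[LHS]/(fun j => Num.max (rmax M P x d.+1 j) (favg j (desc P x d.+2))).
rewrite IH /=.
apply/funext => j; congr (Num.max _ (favg j _)).
exact: (esym (desc_child_at P x d.+1)).
Qed.

Definition exceed P M d : set (Rn R n) :=
  [set x | cube_set P x /\ t < \sum_(0 <= j < J) rmax M P x d j `^ q].

Lemma exceed0 P M : exceed P M 0 =
  if t < \sum_(0 <= j < J) M j `^ q then cube_set P else set0.
Proof.
apply/seteqP; case: ifPn => h; split=> x //=; first by case.
by case=> _ /= h'; rewrite h' in h.
Qed.

Lemma exceedS P M d : exceed P M d.+1 =
  \big[setU/set0]_(e : {ffun 'I_n -> bool})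
    exceed (child P e) (fun j => Num.max (M j) (favg j (child P e))) d.
Proof.
rewrite -bigcup_seq; apply/seteqP; split=> x.
  move=> [Px]; rewrite rmax_child_at => h; eexists; first exact: mem_index_enum.
  by split; [exact: mem_child_at Px|exact: h].
move=> [e _ [ex h]]; split; first exact: child_sub ex.
by rewrite rmax_child_at (child_at_child ex).
Qed.

Lemma measurable_exceed P M d : measurable (exceed P M d).
Proof.
elim: d P M => [|d IH] P M.
  by rewrite exceed0; case: ifP => // _; exact: measurable_cube.
by rewrite exceedS; apply: bigsetU_measurable => e _; exact: IH.
Qed.

(** Split P into its children.  A child where the average of F exceeds lam is
    counted entirely, which Markov's term pays for; the other ones are
    treated by induction with M updated, which decreases [bellman]. *)
Lemma leb_exceed P M d : avg F P \is a fin_num -> lqavg P <= lam ->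
  (forall j, 0 <= M j) ->
  (leb (exceed P M d) <= ((side P)%:num ^+ n * bellman P M)%:E)%E.
Proof.
have lam2 : lam <= 2 ^+ n * lam.
  by rewrite ler_peMl ?(ltW lam_gt0)// exprn_ege1// ler1n.
have bell_ge P' M' : avg F P' \is a fin_num -> lqavg P' <= 2 ^+ n * lam ->
    (forall j, 0 <= M' j) ->
    lqavg P' / lam + (\sum_(0 <= j < J) M' j `^ q) / t <= bellman P' M'.
  move=> P'fin P'lam M'0; rewrite /bellman lerD2l ler_wpM2r ?invr_ge0 ?(ltW t_gt0)//.
  exact: bellman_ge.
have sum0 (M' : nat -> R) : 0 <= \sum_(0 <= j < J) M' j `^ q.
  by apply: sumr_ge0 => j _; exact: powR_ge0.
elim: d P M => [|d IH] P M Pfin Plam M0.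
  have := bell_ge P M Pfin (le_trans Plam lam2) M0.
  have p0 : 0 <= lqavg P / lam by rewrite divr_ge0 ?lqavg_ge0 ?ltW.
  rewrite exceed0; case: ifPn => [tM|_] bP; last first.
    rewrite measure0 lee_fin mulr_ge0 ?exprn_ge0//; apply: le_trans bP.
    by rewrite addr_ge0// divr_ge0// ltW.
  rewrite leb_cube lee_fin ler_peMr ?exprn_ge0//; apply: le_trans bP.
  by rewrite -[leLHS]add0r lerD// ler_pdivlMr// mul1r ltW.
rewrite exceedS.
apply: (le_trans (measure_bigsetU_le leb _ _ _ (fun e => measurable_exceed _ _ _))).
rewrite (bellman_children _ _ Pfin) mulr_sumr -sumEFin; apply: lee_sum => e _.
set P' := child P e.
have P'fin : avg F P' \is a fin_num by exact: avg_child_lq_fin.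
rewrite mulrA -(side_child_pow P e) -/P'.
have [P'lam|P'lam] := leP (lqavg P') lam.
  apply: (le_trans (IH _ _ P'fin P'lam _)).
    by move=> j; rewrite le_max M0.
  rewrite lee_fin ler_wpM2l ?exprn_ge0// /bellman lerD2l.
  rewrite ler_wpM2r ?invr_ge0 ?(ltW t_gt0)// lerD2l.
  apply: ler_sum => j _; apply: doob_fun_max => //; exact: favg_ge0.
apply: (@le_trans _ _ (leb (cube_set P'))).
  apply: le_measure; rewrite ?inE; [exact: measurable_exceed|exact: measurable_cube|].
  by move=> x [].
rewrite leb_cube lee_fin ler_peMr ?exprn_ge0//.
have P'2 : lqavg P' <= 2 ^+ n * lam.
  apply: (le_trans (lqavg_child_le _ Pfin e)).
  by rewrite ler_wpM2l ?exprn_ge0.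
apply: le_trans (bell_ge P' M P'fin P'2 M0).
rewrite -[leLHS]addr0 lerD//; last by rewrite divr_ge0// ltW.
by rewrite ler_pdivlMr// mul1r ltW.
Qed.

End bellman.

(** With lam = 6 lqavg Q and t = weak_cst * lqavg Q ^ q, each of the two terms
    of [bellman] is at most 1/6 when M consists of the averages over Q. *)
Definition weak_cst : R := Num.max 1 (bellman_cst * 6 `^ q).

Lemma weak_cst_ge1 : 1 <= weak_cst. Proof. by rewrite le_max lexx. Qed.

Fixpoint avg_max j Q x d : \bar R :=
  if d is d'.+1 then Order.max (avg_max j Q x d') (avg (absf j) (desc Q x d))
  else avg (absf j) Q.

Lemma avg_max_ge0 j Q x d : (0 <= avg_max j Q x d)%E.
Proof. by case: d => [|d] /=; rewrite ?le_max ?avg_absf_ge0 ?orbT. Qed.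

Lemma desc_lq_fin Q x d :
  avg F Q \is a fin_num -> avg F (desc Q x d) \is a fin_num.
Proof. by move=> Qfin; elim: d => // d IH; exact: avg_child_lq_fin. Qed.

Lemma avg_maxE j Q x d : avg F Q \is a fin_num ->
  avg_max j Q x d = (rmax (favg^~ Q) Q x d j)%:E.
Proof.
move=> Qfin; elim: d => [|d IH]; first by rewrite /= favgE.
rewrite -[LHS]/(Order.max (avg_max j Q x d) (avg (absf j) (desc Q x d.+1))).
by rewrite IH (favgE _ (desc_lq_fin _ _ _ Qfin)) -EFin_max.
Qed.

Lemma avg_max_eq0 j Q x d : avg F Q = 0%E -> avg_max j Q x d = 0%E.
Proof.
move=> Q0; have F0 k : avg F (desc Q x k) = 0%E.
  elim: k => [//|k IH]; apply/eqP; rewrite eq_le avg_lq_norm_ge0 andbT.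
  rewrite descS /child_at; apply: (le_trans (avg_child_le _ mF lq_norm_ge0)).
  by rewrite IH mule0.
have f0 k : avg (absf j) (desc Q x k) = 0%E.
  apply/eqP; rewrite eq_le avg_absf_ge0 andbT -(F0 k).
  exact: avg_absf_le.
elim: d => [|d IH]; first exact: (f0 0).
rewrite -[LHS]/(Order.max (avg_max j Q x d) (avg (absf j) (desc Q x d.+1))).
by rewrite IH f0 maxxx.
Qed.

Lemma rmax_ge0 M P x d j : (forall j, 0 <= M j) -> 0 <= rmax M P x d j.
Proof. by move=> M0; elim: d => [|d IH]; rewrite //= le_max IH. Qed.

Lemma rmax_le M P x d d' j : (d <= d')%N -> rmax M P x d j <= rmax M P x d' j.
Proof.
move=> /subnKC <-; elim: (d' - d)%N => [|k IH]; first by rewrite addn0.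
by rewrite addnS /= le_max IH.
Qed.

Lemma sum_rmax_le M P x J J' d d' :
  (forall j, 0 <= M j) -> (J <= J')%N -> (d <= d')%N ->
  \sum_(0 <= j < J) rmax M P x d j `^ q <=
  \sum_(0 <= j < J') rmax M P x d' j `^ q.
Proof.
move=> M0 JJ' dd'; rewrite (big_cat_nat _ JJ')//= -[leLHS]addr0 lerD//.
  apply: ler_sum => j _; rewrite ge0_ler_powR ?nnegrE ?rmax_ge0 ?(ltW q_gt0)//.
  exact: rmax_le.
by apply: sumr_ge0 => j _; exact: powR_ge0.
Qed.

Lemma exceed_le t P M d d' : (forall j, 0 <= M j) -> (d <= d')%N ->
  exceed d t P M d `<=` exceed d' t P M d'.
Proof.
move=> M0 dd' x [Px h]; split=> //; apply: (lt_le_trans h).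
exact: sum_rmax_le.
Qed.

(** The Fefferman--Stein weak type inequality on a single cube, in the form
    used by the stopping argument: one exceptional set serves all truncations
    J and all generations d. *)
Lemma vector_weak_type Q : exists B : set (Rn R n),
  [/\ measurable B,
      (leb B <= (3^-1 * (side Q)%:num ^+ n)%:E)%E
    & forall x J d, cube_set Q x -> ~ B x ->
      (\sum_(0 <= j < J) avg_max j Q x d `^ q <=
       weak_cst%:E * avg F Q `^ q)%E].
Proof.
have c1 := weak_cst_ge1.
have [Qoo|Qoo] := eqVneq (avg F Q) +oo%E.
  exists set0; split; rewrite ?measure0 ?lee_fin ?mulr_ge0 ?exprn_ge0//.
  move=> x J d _ _; rewrite Qoo poweRyr ?lt0r_neq0// gt0_muley ?leey//.
  by rewrite lte_fin (lt_le_trans ltr01).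
have Qfin : avg F Q \is a fin_num.
  by rewrite ge0_fin_numE ?avg_lq_norm_ge0// lt_neqAle Qoo leey.
have [Q0|Qn0] := eqVneq (avg F Q) 0%E.
  exists set0; split; rewrite ?measure0 ?lee_fin ?mulr_ge0 ?exprn_ge0//.
  move=> x J d _ _; rewrite big1 => [|j _].
    by rewrite mule_ge0 ?poweR_ge0// lee_fin (le_trans ler01).
  by rewrite avg_max_eq0// poweR0r// lt0r_neq0.
have V0 : 0 < lqavg Q.
  by rewrite lt_neqAle lqavg_ge0 andbT eq_sym -(inj_eq (@EFin_inj _)) -lqavgE.
set V := lqavg Q in V0.
pose t := weak_cst * V `^ q.
have t0 : 0 < t by rewrite mulr_gt0 ?powR_gt0// (lt_le_trans ltr01).
have M0 j : 0 <= favg j Q by exact: favg_ge0.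
pose B_ d := exceed d t Q (favg^~ Q) d.
have mB d : measurable (B_ d) by exact: measurable_exceed.
have leB d : (leb (B_ d) <= (3^-1 * (side Q)%:num ^+ n)%:E)%E.
  have l0 : 0 < 6 * V by rewrite mulr_gt0.
  apply: (le_trans (leb_exceed d (6 * V) t l0 t0 Q _ d Qfin _ M0)).
    by rewrite ler_peMl ?(ltW V0)// ler1n.
  rewrite lee_fin mulrC ler_wpM2r ?exprn_ge0// /bellman -/V.
  have -> : V / (6 * V) = 6^-1 by field; exact: lt0r_neq0.
  suff : (bellman_cst * (6 * V) `^ (q - 1) * V +
      \sum_(0 <= j < d) doob_fun q (favg j Q) (favg j Q)) / t <= 6^-1 by lra.
  rewrite ler_pdivrMr//.
  have : \sum_(0 <= j < d) doob_fun q (favg j Q) (favg j Q) <= 0.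
    by apply: sumr_le0 => j _; exact: doob_fun_diag.
  suff : bellman_cst * (6 * V) `^ (q - 1) * V <= 6^-1 * t by lra.
  rewrite powRM ?(ltW V0)// -!mulrA (powRB1_mull _ q_gt1 (ltW V0)) /t !mulrA.
  rewrite ler_wpM2r ?powR_ge0//.
  rewrite ler_pdivlMl//.
  have -> : 6 * (bellman_cst * 6 `^ (q - 1)) = bellman_cst * 6 `^ q.
    by rewrite -(@powRB1_mull _ _ q_gt1 6)//; ring.
  by rewrite le_max lexx orbT.
exists (\bigcup_d B_ d); split.
- exact: bigcup_measurable.
- have ndB : {homo B_ : d d' / (d <= d')%N >-> (d <= d')%O}.
    by move=> d d' dd'; apply/subsetPset; exact: exceed_le.
  have cvg := @nondecreasing_cvg_mu _ _ _ (@leb R n) _ mB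
    (bigcup_measurable (fun d _ => mB d)) ndB.
  rewrite -(cvg_lim _ cvg)//; apply: lime_le.
    by apply/cvg_ex; eexists; exact: cvg.
  by near=> d; exact: leB.
- move=> x J d Qx nB; rewrite leNgt; apply/negP => h; apply: nB.
  exists (maxn J d) => //; split=> //.
  rewrite -lte_fin /t EFinM -poweR_EFin -lqavgE//; apply: (lt_le_trans h).
  under eq_bigr do rewrite avg_maxE// poweR_EFin.
  by rewrite sumEFin lee_fin sum_rmax_le ?leq_maxl ?leq_maxr.
Unshelve. all: by end_near. Qed.

End weak_type.

(** * Stopping cubes *)
Arguments desc : simpl never.
Arguments avg_max : simpl never.

Section stopping.
Context {R : realType} {n : nat} {q : R}.
Hypothesis q_gt1 : (1 < q)%R.
Variable f : nat -> Rn R n -> R.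
Hypothesis mf : forall j, measurable_fun setT (f j).
Variable b : {ffun 'I_n -> bool}.
Implicit Types (Q P A : cube R n) (x : 'rV[R]_n).
Local Open Scope ereal_scope.

Let q_gt0 : (0 < q)%R. Proof. exact: lt_trans q_gt1. Qed.

Local Notation F := (lq_norm q f).
Local Notation absf := (absf f).
Local Notation avg_max := (avg_max f).
Local Notation C := (@weak_cst R n q).
Local Notation chain := (@chain R n b).

(** Whether the process restarts at generation k below A.  Chain cubes are
    forced in so that the outcome does not depend on the top cube. *)
Definition reset A x k : Prop :=
  (exists N, desc A x k = chain N) \/
  (exists J, C%:E * avg F A `^ q < \sum_(0 <= j < J) avg_max j A x k `^ q).

(** A state (A, k) records the last stopping cube A and the number k of
    generations since; a stopping cube has just been reached when k = 0. *)
Definition step x (s : cube R n * nat) : cube R n * nat :=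
  if `[< reset s.1 x s.2.+1 >] then (desc s.1 x s.2.+1, 0%N) else (s.1, s.2.+1).

Definition state Q x d := iter d (step x) (Q, 0%N).

Lemma stateS Q x d : state Q x d.+1 = step x (state Q x d).
Proof. by []. Qed.

Lemma stateD Q x d k : state Q x (d + k) = iter k (step x) (state Q x d).
Proof. by rewrite /state addnC iterD. Qed.

Lemma desc_state Q x d : desc (state Q x d).1 x (state Q x d).2 = desc Q x d.
Proof.
elim: d => [//|d IH]; rewrite stateS /step; case: ifP => _;
by rewrite -[LHS]/(desc (state Q x d).1 x (state Q x d).2.+1) !descS IH.
Qed.

Lemma state0 {Q x d P} : state Q x d = (P, 0%N) -> P = desc Q x d.
Proof. by move=> h; have := desc_state Q x d; rewrite h. Qed.

Lemma state_chain Q x d N : desc Q x d.+1 = chain N -> state Q x d.+1 = (chain N, 0%N).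
Proof.
move=> h; have := desc_state Q x d; rewrite stateS.
case: (state Q x d) => A k /= Ak; rewrite /step /=.
have AkN : desc A x k.+1 = chain N by rewrite descS Ak.
by case: asboolP => [_|[]]; [rewrite AkN|left; exists N].
Qed.

(** Starting from a larger cube of the chain leads to the same states, because
    the process restarts at [chain N]. *)
Lemma state_chainD N M x d : cube_set (chain N) x ->
  state (chain (N + M)) x (M + d) = state (chain N) x d.
Proof.
move=> xN; rewrite stateD; congr iter; case: M => [|M]; first by rewrite addn0.
by apply: state_chain; have [_ ->] := @chain_desc _ _ b N M.+1 _ xN.
Qed.

Lemma avg_max_congr j A x y k :
  (forall i, (i <= k)%N -> desc A x i = desc A y i) ->
  avg_max j A x k = avg_max j A y k.
Proof.
elim: k => [//|k IH] h.
rewrite -[LHS]/(maxe (avg_max j A x k) (avg (absf j) (desc A x k.+1))).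
by rewrite IH => [|i ik]; rewrite ?h// (leq_trans ik).
Qed.

(** The state depends only on the cubes passed through, so that being a
    stopping cube does not depend on the point used to reach it. *)
Lemma state_congr Q x y d :
  cube_set (desc Q y d) x -> state Q x d = state Q y d.
Proof.
elim: d => [//|d IH] h.
have hd : cube_set (desc Q y d) x.
  by apply: (desc_sub _ _ d 1); rewrite addn1.
rewrite !stateS (IH hd); have := desc_state Q y d.
case: (state Q y d) => A k /= Ak; rewrite /step /=.
have AE i : (i <= k.+1)%N -> desc A x i = desc A y i.
  by move=> ik; apply: (desc_eq_le ik); rewrite descS Ak.
have rE : reset A x k.+1 = reset A y k.+1.
  rewrite /reset AE//; congr (_ \/ _); congr ex; apply/funext => J.
  by congr (_ < _); apply: eq_bigr => j _; rewrite (avg_max_congr _ _ _ _ _ AE).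
by rewrite rE AE.
Qed.

Definition stopping : set (cube R n) :=
  [set P | exists N x d, cube_set (chain N) x /\ state (chain N) x d = (P, 0%N)].

Lemma stopping_lattice : stopping `<=` lattice b.
Proof. by move=> P [N [x [d [_ /state0 ->]]]]; exists N; exact: desc_grid. Qed.

Lemma stopping_path {P x} : stopping P -> cube_set P x ->
  exists N0, forall N, (N0 <= N)%N ->
    cube_set (chain N) x /\ exists d, state (chain N) x d = (P, 0%N).
Proof.
move=> [N0 [y [d [yN0 h]]]] Px; have PE := state0 h; exists N0 => N N0N.
have xN0 : cube_set (chain N0) x.
  by apply: (desc_sub _ y 0 d); rewrite add0n -PE.
split; first exact: (chain_desc_le N0N xN0).1.
exists (N - N0 + d)%N; rewrite -{1}(subnKC N0N) state_chainD//.
by rewrite (state_congr _ x y) ?h// -PE.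
Qed.

Definition stopped_sum Q x d : \bar R :=
  \sum_(0 <= s < d.+1 | (state Q x s).2 == 0%N) avg F (desc Q x s) `^ q.

(** The induction carries e_j, the cost of the j-th sequence before the current
    stopping cube: the q-th power of the running maximum is at most e_j plus
    that of the maximum since the last stop. *)
Lemma stopped_sum_dominates J Q x d :
  \sum_(0 <= j < J) avg_max j Q x d `^ q <= C%:E * stopped_sum Q x d.
Proof.
have C1 : 1 <= C%:E by rewrite lee_fin weak_cst_ge1.
have C0 : 0 <= C%:E by exact: le_trans C1.
have CF A : avg F A `^ q <= C%:E * avg F A `^ q.
  by rewrite -{1}[_ `^ q]mul1e lee_wpmul2r ?poweR_ge0.
suff [e [e0 he hS hA]] : exists e : nat -> \bar R,
    let s := state Q x d in
    [/\ forall j, 0 <= e j,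
        forall j, avg_max j Q x d `^ q <= e j + avg_max j s.1 x s.2 `^ q,
        \sum_(0 <= j < J) e j + C%:E * avg F s.1 `^ q <= C%:E * stopped_sum Q x d
      & \sum_(0 <= j < J) avg_max j s.1 x s.2 `^ q <= C%:E * avg F s.1 `^ q].
  apply: le_trans hS; apply: le_trans (leeD2l _ hA).
  by rewrite -big_split/=; apply: lee_sum => j _; exact: he.
elim: d => [|d [e [e0 he hS hA]]].
  exists (fun=> 0); split => //=.
  - by move=> j; rewrite add0e.
  - rewrite big1// add0e /stopped_sum big_mkcond big_nat1/=.
    by [].
  - by apply: le_trans (CF Q); exact: avg_minkowski.
have := desc_state Q x d; move: he hS hA; rewrite stateS.
case sE : (state Q x d) => [A k] /= he hS hA Ak.
have AS : desc A x k.+1 = desc Q x d.+1 by rewrite !descS Ak.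
have maxS j : avg_max j Q x d.+1 = maxe (avg_max j Q x d) (avg (absf j) (desc Q x d.+1)).
  by [].
have GS : stopped_sum Q x d.+1 = stopped_sum Q x d +
    (if (state Q x d.+1).2 == 0%N then avg F (desc Q x d.+1) `^ q else 0).
  by rewrite /stopped_sum big_mkcond big_nat_recr//= -big_mkcond.
rewrite GS stateS sE /step /=; case: asboolP => [_|nr] /=.
- exists (fun j => e j + avg_max j A x k `^ q); split.
  + by move=> j; rewrite adde_ge0 ?poweR_ge0.
  + move=> j; rewrite maxS AS.
    apply: (@le_trans _ _ (avg_max j Q x d `^ q + avg (absf j) (desc Q x d.+1) `^ q)).
      case: (leP (avg_max j Q x d) (avg (absf j) (desc Q x d.+1))) => _.
        by rewrite leeDr ?poweR_ge0.
      by rewrite leeDl ?poweR_ge0.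
    by apply: leeD2r; exact: he.
  + rewrite big_split/= ge0_muleDr ?poweR_ge0//; last first.
      by apply: sume_ge0 => *; exact: poweR_ge0.
    rewrite AS leeD2r//; apply: le_trans hS; exact: leeD2l.
  + by apply: le_trans (CF _); exact: avg_minkowski.
- exists e; split => //.
  + move=> j; rewrite maxS.
    rewrite -[avg_max j A x k.+1]/(maxe (avg_max j A x k)
      (avg (absf j) (desc A x k.+1))) AS.
    set v := avg _ _; set a := avg_max j Q x d; set r := avg_max j A x k.
    have r0 : 0 <= r by exact: avg_max_ge0.
    case: (leP a v) => _.
      apply: (@le_trans _ _ (maxe r v `^ q)); last by rewrite leeDr.
      by rewrite poweR_le ?avg_absf_ge0 ?(ltW q_gt0)// le_max lexx orbT.
    apply: (le_trans (he j)); apply: leeD2l.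
    by rewrite poweR_le ?(ltW q_gt0)// le_max lexx.
  + by rewrite adde0.
  + rewrite leNgt; apply/negP => h; apply: nr; right; exists J.
    exact: h.
Qed.

Lemma stopped_sum_le_esum N x d : cube_set (chain N) x ->
  stopped_sum (chain N) x d <=
  \esum_(P in stopping) (avg F P `^ q * (\1_(cube_set P) x)%:E).
Proof.
move=> xN; apply: esum_ge.
pose s := [seq desc (chain N) x i |
  i <- [seq i <- index_iota 0 d.+1 | (state (chain N) x i).2 == 0%N]].
exists [set` s].
  split; first exact: finite_seq.
  move=> P /= /mapP[i]; rewrite mem_filter => /andP[/eqP h _] ->.
  exists N, x, i; split=> //; have := desc_state (chain N) x i.
  by move: h; case: (state _ _ _) => A k /= -> <-.
rewrite -fsbig_seq ?map_inj_uniq ?filter_uniq ?iota_uniq//; last exact: desc_inj.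
rewrite big_map big_filter /stopped_sum; apply: lee_sum => i _.
by rewrite indicE mem_set ?mule1//; exact: mem_desc.
Qed.

(** Two stopping cubes through x lie on the same path of states, and the later
    one is reached by a reset after the earlier one. *)
Lemma stopping_disjoint (E : cube R n -> set (Rn R n)) :
  (forall P x d, stopping P -> E P x -> (0 < d)%N -> ~ reset P x d) ->
  (forall P, E P `<=` cube_set P) -> trivIset stopping E.
Proof.
move=> nr sE P Q SP SQ [x [PE QE]].
have [N1 h1] := stopping_path SP (sE _ _ PE).
have [N2 h2] := stopping_path SQ (sE _ _ QE).
have [_ [d hd]] := h1 _ (leq_maxl N1 N2).
have [_ [k hk]] := h2 _ (leq_maxr N1 N2).
move: hd hk; set T := chain _.
have stay A a m : stopping A -> E A x ->
    state T x a = (A, 0%N) -> state T x (a + m) = (A, m).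
  move=> SA AE ha; elim: m => [|m IH]; first by rewrite addn0.
  rewrite addnS stateS IH /step /=; case: asboolP => // r.
  by case: (nr _ _ m.+1 SA AE _ r).
case: (leqP d k) => [/subnKC <-|/ltnW/subnKC <-] ha.
  by rewrite (stay _ _ _ SP PE ha) => -[].
by move=> hb; move: ha; rewrite (stay _ _ _ SQ QE hb) => -[].
Qed.

(** The part of a chain cube covered by the preceding cube of the chain; empty
    for all other cubes. *)
Definition chain_below Q : set (Rn R n) :=
  [set x | exists N, Q = chain N.+1 /\ cube_set (chain N) x].

Lemma chain_belowP Q :
  chain_below Q = set0 \/
  exists N, Q = chain N.+1 /\ chain_below Q = cube_set (chain N).
Proof.
have [[N QN]|h] := pselect (exists N, Q = chain N.+1); [right|left].
  exists N; split=> //; apply/seteqP; split=> x; last by move=> xN; exists N.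
  by move=> [M []]; rewrite QN => /chain_inj [->].
by rewrite -subset0 => x [N [QN _]]; apply: h; exists N.
Qed.

Lemma measurable_chain_below Q : measurable (chain_below Q).
Proof.
by have [->|[N [_ ->]]] := chain_belowP Q => //; exact: measurable_cube.
Qed.

Lemma leb_chain_below Q : (0 < n)%N ->
  leb (chain_below Q) <= (2^-1 * (side Q)%:num ^+ n)%:E.
Proof.
move=> n0; have [->|[N [-> ->]]] := chain_belowP Q.
  by rewrite measure0 lee_fin mulr_ge0 ?exprn_ge0.
rewrite leb_cube lee_fin /= ler_pdivlMl// exprS exprMn ler_wpM2r ?exprn_ge0//.
by rewrite -[leLHS]expr1 ler_eXn2l ?ltr1n.
Qed.

(** A cube of the chain sits only below other cubes of the chain. *)
Lemma reset_chain N x d m M : cube_set (chain N) x ->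
  desc (chain N) x (d + m.+1) = chain M -> chain_below (desc (chain N) x d) x.
Proof.
move=> xN e.
have NE : N = (M + m.+1 + d)%N.
  have := congr1 (fun P => (side P)%:num) e; rewrite side_desc /= => h.
  apply: (@expr2_inj R); rewrite /= -addnA [(m.+1 + d)%N]addnC exprD -h.
  by rewrite divfK// expf_neq0// pnatr_eq0.
have xM : cube_set (chain M) x by rewrite -e; exact: mem_desc.
have xm := (chain_desc xM).1.
rewrite NE (chain_desc (xm m.+1)).2; exists (M + m)%N; rewrite addnS; split=> //.
Qed.

Lemma stopping_sparse : (0 < n)%N -> sparse 6^-1 stopping.
Proof.
move=> n0; have [B hB] := choice (vector_weak_type q_gt1 f mf).
pose E Q : set (Rn R n) := cube_set Q `\` (B Q `|` chain_below Q).
exists E; split.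
  move=> Q _; have [mB leB _] := hB Q.
  have mU : measurable (B Q `|` chain_below Q).
    by apply: measurableU => //; exact: measurable_chain_below.
  have mE : measurable (E Q) by apply: measurableD => //; exact: measurable_cube.
  split=> //; first exact: subDsetl.
  have leU := le_trans (measureU2 leb mB (measurable_chain_below Q))
    (leeD leB (leb_chain_below Q n0)).
  have : leb (cube_set Q) <= leb (E Q) + leb (B Q `|` chain_below Q).
    apply: le_trans (measureU2 leb mE mU).
    apply: le_measure; rewrite ?inE; [exact: measurable_cube|exact: measurableU|].
    move=> x Qx; have [Ux|nUx] := pselect ((B Q `|` chain_below Q) x).
      by right.
    by left.
  move=> /le_trans -/(_ _ (leeD2l _ leU)); rewrite leb_cube.
  case: (leb (E Q)) => [r| |]; rewrite -?EFinM ?leey// -?EFinD ?lee_fin//.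
  by move: ((side Q)%:num ^+ n)%R => s; lra.
apply: stopping_disjoint => [Q x d SQ [Qx nQ] d0|Q]; last exact: subDsetl.
move=> [[M e]|[J]]; last first.
  have [_ _ hQ] := hB Q; rewrite ltNge => /negP; apply; apply: hQ => // BQ.
  by apply: nQ; left.
apply: nQ; right; have [N0 /(_ _ (leqnn N0))[xN [k hk]]] := stopping_path SQ Qx.
rewrite (state0 hk); apply: (@reset_chain _ _ _ d.-1 M xN).
by rewrite prednK// descD -(state0 hk).
Qed.

End stopping.

(** * Domination of the maximal function *)
Section domination.
Context {R : realType} {n : nat} {q : R}.
Hypothesis q_gt1 : (1 < q)%R.
Variable f : nat -> Rn R n -> R.
Hypothesis mf : forall j, measurable_fun setT (f j).
Implicit Types (Q P : cube R n) (x : 'rV[R]_n) (b : {ffun 'I_n -> bool}).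
Local Open Scope ereal_scope.

Let q_gt0 : (0 < q)%R. Proof. exact: lt_trans q_gt1. Qed.
Let q_neq0 : q != 0%R. Proof. exact: lt0r_neq0. Qed.

Local Notation F := (lq_norm q f).
Local Notation C := (@weak_cst R n q).

Definition sparse_sum b x : \bar R :=
  \esum_(P in @stopping R n q f b) (avg F P `^ q * (\1_(cube_set P) x)%:E).

Lemma sparse_sum_ge0 b x : 0 <= sparse_sum b x.
Proof. by apply: esum_ge0 => P _; rewrite mule_ge0// poweR_ge0. Qed.

Lemma avg_max_ge j Q x d D :
  (d <= D)%N -> avg (absf f j) (desc Q x d) <= avg_max f j Q x D.
Proof.
have step i : avg_max f j Q x i <= avg_max f j Q x i.+1.
  by rewrite [leRHS]/(avg_max f j Q x i.+1)/= le_max lexx.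
move=> /subnKC <-; elim: (D - d)%N => [|k IH].
  by rewrite addn0; case: d => [|d]//=; rewrite le_max lexx orbT.
by rewrite addnS; exact: le_trans (step _).
Qed.

(** Choose one cube for each j, dilate it into a lattice cube, and view these
    finitely many lattice cubes on the paths from a common generation of the
    chains, down to a common depth. *)
Lemma maximal_sum_le (I : finType) (b_ : I -> {ffun 'I_n -> bool}) x J :
  (forall b, exists i, b_ i = b) ->
  \sum_(0 <= j < J) maximal (f j) x `^ q <=
  ((6 ^+ n) `^ q * C)%:E * \sum_(i : I) sparse_sum (b_ i) x.
Proof.
move=> b_surj; rewrite -[leLHS]add0e; apply: sum_poweR_sup_le => //.
- move=> j; have [N hN] := @chain_cover R n `|x|%R.
  exists (avg (absf f j) (chain [ffun=> true] N)); exists (chain [ffun=> true] N) => //.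
  by apply: hN => i; exact: normr_coor_le.
- by move=> j _ [Q _ <-]; apply: avg_ge0 => y; rewrite lee_fin.
move=> y hy; rewrite add0e.
have /choice[Q_ hQ] : forall j, exists Q, cube_set Q x /\ avg (absf f j) Q = y j.
  by move=> j; have [Q Qx yE] := hy j; exists Q.
have /choice[N0 hN0] := fun j => cube_cover (Q_ j) x (hQ j).1.
have [N1 hN1] := chain_cover_pt x.
pose N := maxn N1 (\max_(j < J) N0 j).
have xN b : cube_set (chain b N) x by apply: hN1; exact: leq_maxl.
have /choice[p hp] : forall j, exists p : I * nat, (j < J)%N ->
    y j <= (6 ^+ n)%:E * avg (absf f j) (desc (chain (b_ p.1) N) x p.2).
  move=> j; have [jJ|Jj] := ltnP j J; last first.
    by have [i _] := b_surj [ffun=> true]; exists (i, 0%N).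
  have [|b [d [sub le6]]] := hN0 j N.
    by rewrite leq_max (leq_bigmax (Ordinal jJ)) orbT.
  have [i iE] := b_surj b; exists (i, d) => _; rewrite /= iE -(hQ j).2.
  by apply: avg_dilate le6 => //; [exact: measurable_absf|exact: absf_ge0].
pose D := \max_(j < J) (p j).2.
have term j : (j < J)%N -> y j `^ q <=
    ((6 ^+ n) `^ q)%:E * \sum_(i : I) avg_max f j (chain (b_ i) N) x D `^ q.
  move=> jJ; rewrite (bigD1 (p j).1)//=.
  apply: (@le_trans _ _ (((6 ^+ n)%:E * avg_max f j (chain (b_ (p j).1) N) x D) `^ q)).
    apply: poweR_le; first exact: ltW.
      by rewrite -(hQ j).2; apply: avg_ge0 => z; exact: absf_ge0.
    apply: (le_trans (hp j jJ)); rewrite lee_wpmul2l ?lee_fin ?exprn_ge0//.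
    by apply: avg_max_ge; exact: (leq_bigmax (Ordinal jJ)).
  rewrite poweRM ?avg_max_ge0 ?lee_fin ?exprn_ge0// poweR_EFin.
  rewrite lee_wpmul2l ?lee_fin ?powR_ge0// leeDl// sume_ge0// => i _.
  exact: poweR_ge0.
rewrite big_mkord; apply: (@le_trans _ _ (\sum_(j < J) ((6 ^+ n) `^ q)%:E *
    \sum_(i : I) avg_max f j (chain (b_ i) N) x D `^ q)).
  by apply: lee_sum => j _; exact: term.
rewrite -ge0_sume_distrr; last first.
  by move=> j _; apply: sume_ge0 => i _; exact: poweR_ge0.
rewrite EFinM -muleA lee_wpmul2l ?lee_fin ?powR_ge0// exchange_big/=.
rewrite ge0_sume_distrr; last by move=> i _; exact: sparse_sum_ge0.
apply: lee_sum => i _; rewrite -(big_mkord xpredT (fun j => avg_max f j _ x D `^ q)).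
apply: (le_trans (stopped_sum_dominates q_gt1 f mf (b_ i) J _ x D)).
rewrite lee_wpmul2l ?lee_fin ?(le_trans ler01 weak_cst_ge1)//.
exact: stopped_sum_le_esum.
Qed.

Lemma vmaximal_le (I : finType) (b_ : I -> {ffun 'I_n -> bool}) x :
  (forall b, exists i, b_ i = b) ->
  vmaximal q f x <= (((6 ^+ n) `^ q * C * #|I|%:R) `^ q^-1)%:E *
    \sum_(i : I) sparse_op q (@stopping R n q f (b_ i)) F x.
Proof.
move=> b_surj; set T := \sum_(i : I) _.
have T0 : 0 <= T by apply: sume_ge0 => i _; exact: poweR_ge0.
have TE i : sparse_sum (b_ i) x <= T `^ q.
  rewrite -(poweRVK q_neq0 (sparse_sum_ge0 _ _)).
  apply: poweR_le; rewrite ?poweR_ge0 ?(ltW q_gt0)//.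
  rewrite /T (bigD1 i)//= leeDl// sume_ge0// => k _; exact: poweR_ge0.
have c0 : (0 <= (6 ^+ n) `^ q * C)%R.
  by rewrite mulr_ge0 ?powR_ge0// (le_trans ler01 weak_cst_ge1).
have S_le : \sum_(j <oo) maximal (f j) x `^ q <=
    ((6 ^+ n) `^ q * C * #|I|%:R)%:E * T `^ q.
  apply: lime_le; first by apply: is_cvg_nneseries => j _ _; exact: poweR_ge0.
  near=> J; apply: (le_trans (maximal_sum_le _ b_ x J b_surj)).
  rewrite [in leRHS]EFinM -muleA lee_wpmul2l ?lee_fin//.
  have -> : #|I|%:R%:E = \sum_(i : I) 1%:E :> \bar R by rewrite sumEFin sumr_const.
  rewrite ge0_sume_distrl//; apply: lee_sum => i _.
  by rewrite mul1e; exact: TE.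
rewrite /vmaximal -(poweRK q_neq0 T0) -poweR_EFin -poweRM ?poweR_ge0//; last first.
  by rewrite lee_fin mulr_ge0.
apply: poweR_le => //; first by rewrite invr_ge0 ltW.
by apply: nneseries_ge0 => j _ _; exact: poweR_ge0.
Unshelve. all: by end_near. Qed.

End domination.

(** The 2^n phases are distributed over 3^n labels, with repetitions. *)
Lemma ord_surj_ffun_bool n :
  exists b_ : 'I_(3 ^ n) -> {ffun 'I_n -> bool}, forall b, exists i, b_ i = b.
Proof.
exists (fun i => nth [ffun=> true] (enum {ffun 'I_n -> bool}) i) => b.
have lt3 : (index b (enum {ffun 'I_n -> bool}) < 3 ^ n)%N.
  apply: (@leq_trans (2 ^ n)); last by case: (n) => // k; rewrite leq_exp2r.
  have -> : (2 ^ n = #|{ffun 'I_n -> bool}|)%N by rewrite card_ffun card_bool card_ord.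
  by rewrite cardE index_mem mem_enum.
by exists (Ordinal lt3); rewrite /= nth_index// mem_enum.
Qed.

Theorem theorem1 (R : realType) (n : nat) (q : R) (n_gt0 : (0 < n)%N)
    (q_gt1 : 1 < q) :
  exists2 c : R, 0 < c &
  forall f : nat -> Rn R n -> R,
    (forall j, measurable_fun setT (f j)) ->
    (forall eps : R, 0 < eps ->
      ((leb [set x | centered_box r x /\ eps%:E < `|vmaximal q f x|]
         / (r ^+ n)%:E) @[r --> +oo%R] --> 0)%E) ->
    exists D S : 'I_(3 ^ n) -> set (cube R n),
      (forall k, [/\ dyadic_lattice (D k), S k `<=` D k & sparse 6^-1 (S k)]) /\
      {ae @leb R n, forall x,
        (`|vmaximal q f x| <=
           c%:E * \sum_(k < 3 ^ n) sparse_op q (S k) (lq_norm q f) x)%E}.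
Proof.
have [b_ b_surj] := ord_surj_ffun_bool n.
exists (((6 ^+ n) `^ q * @weak_cst R n q * #|'I_(3 ^ n)|%:R) `^ q^-1).
  rewrite powR_gt0// !mulr_gt0 ?powR_gt0 ?exprn_gt0//.
    exact: lt_le_trans weak_cst_ge1.
  by rewrite card_ord ltr0n expn_gt0.
move=> f mf _; exists (fun k => lattice (b_ k)), (fun k => @stopping R n q f (b_ k)).
split=> [k|].
  split; first exact: lattice_dyadic.
    exact: stopping_lattice.
  exact: stopping_sparse.
apply: aeW => x; rewrite gee0_abs ?poweR_ge0//.
exact: vmaximal_le.
Qed.
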